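(* On an almost Hermitian manifold $(M^4,g,I)$ the following are equivalent: (i) the curvature of the canonical Hermitian connection is generated by the K\''ahler form of $I$: $$\widetilde R=\frac12\,\widetilde\gamma_1\otimes\omega_I;$$ (ii) $\mathrm{Ric}=0$ and $W^-=0$.
   Context: Almost Hermitian: $g$ is a Riemannian metric and $I$ an almost complex structure with $g(I\cdot,I\cdot)=g$; $\omega_I=g(I\cdot,\cdot)$ and $M$ is oriented so that $\omega_I$ is selfdual. $\mathrm{Ric}$ is the Ricci tensor of $g$ and $W^-$ the anti-selfdual half of its Weyl tensor. With $\nabla$ the Levi-Civita connection, the canonical Hermitian connection is $\widetilde\nabla_XY=\nabla_XY+\frac12(\nabla_XI)IY$, with curvature $\widetilde R(X,Y)=-[\widetilde\nabla_X,\widetilde\nabla_Y]+\widetilde\nabla_{[X,Y]}$. Skew endomorphisms $A$ are identified with $2$-forms $g(A\cdot,\cdot)$, so $\widetilde R$ takes values in $2$-forms, and $(\beta\otimes\omega_I)(X,Y)=\beta(X,Y)\omega_I$. The first Chern form is $\widetilde\gamma_1(X,Y)=\langle\widetilde R(X,Y),\omega_I\rangle$, with the standard inner product on $2$-forms (for which $e^i\wedge e^j$, $i<j$, are orthonormal, so $|\omega_I|^2=2$). *)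

(* Defs.v *)
From HB Require Import structures.
From mathcomp Require Import all_boot all_order all_algebra.
From mathcomp Require Import all_classical all_reals.
From mathcomp Require Import topology normedtype derive.

Set Implicit Arguments.
Unset Strict Implicit.
Unset Printing Implicit Defensive.

Import Order.TTheory GRing.Theory Num.Theory.
Import numFieldNormedType.Exports.

Local Open Scope classical_set_scope.
Local Open Scope ring_scope.

(** * Calculus on open subsets of R^4, points being column vectors *)

Definition evec (R : realType) (i : 'I_4) : 'cV[R]_4 := delta_mx i 0.

Definition partial (R : realType) (i : 'I_4) (f : 'cV[R]_4 -> R) :
  'cV[R]_4 -> R := fun x => 'D_(evec R i) f x.

Fixpoint Cn (R : realType) (n : nat) (U : set 'cV[R]_4) (f : 'cV[R]_4 -> R) :
    Prop :=
  (forall x, U x -> {for x, continuous f}) /\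
  (if n is n'.+1 then
     forall i : 'I_4, (forall x, U x -> derivable f x (evec R i)) /\
                      Cn n' U (partial i f)
   else True).

Definition smooth (R : realType) (U : set 'cV[R]_4) (f : 'cV[R]_4 -> R) :=
  forall n, Cn n U f.

Definition smooth_mx (R : realType) (m n : nat) (U : set 'cV[R]_4)
    (F : 'cV[R]_4 -> 'M[R]_(m, n)) :=
  forall i j, smooth U (fun x => F x i j).

Definition jac (R : realType) (F : 'cV[R]_4 -> 'cV[R]_4) (x : 'cV[R]_4) :
  'M[R]_4 := \matrix_(i, j) partial j (fun y => F y i 0) x.

(** * Smooth 4-manifolds *)

(* The functions [coord c] and [param c] are total, but are only meaningful on
   [dom c] and on its image respectively. *)
Record manifold4 (R : realType) := Manifold4 {
  carrier :> topologicalType;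
  hausdorffM : hausdorff_space carrier;
  second_countableM : @second_countable carrier;
  chart : Type;
  dom : chart -> set carrier;
  coord : chart -> carrier -> 'cV[R]_4;
  param : chart -> 'cV[R]_4 -> carrier;
  dom_open : forall c, open (dom c);
  dom_cover : forall p : carrier, exists c, dom c p;
  img_open : forall c, open (coord c @` dom c);
  coordK : forall c p, dom c p -> param c (coord c p) = p;
  coord_cont : forall c p, dom c p -> {for p, continuous (coord c)};
  param_cont : forall c x, (coord c @` dom c) x -> {for x, continuous (param c)};
  transition_smooth : forall c d,
    smooth_mx (coord c @` (dom c `&` dom d)) (fun x => coord d (param c x))
}.

Section Manifold.
Variables (R : realType) (M : manifold4 R).

Definition img (c : chart M) : set 'cV[R]_4 := coord c @` dom c.

Definition overlap (c d : chart M) : set 'cV[R]_4 :=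
  coord c @` (dom c `&` dom d).

Definition transition (c d : chart M) : 'cV[R]_4 -> 'cV[R]_4 :=
  fun x => coord d (param c x).

(* [orient c x] is the sign of the coordinate frame of [c] at the point with
   coordinates [x]. *)
Record orientation := Orientation {
  orient :> chart M -> 'cV[R]_4 -> R;
  orient_pm : forall c x, img c x -> orient c x = 1 \/ orient c x = -1;
  orient_cont : forall c x, img c x -> {for x, continuous (orient c)};
  orient_change : forall c d x, overlap c d x ->
    orient c x = Num.sg (\det (jac (transition c d) x))
                 * orient d (transition c d x)
}.

(* Tensor fields are given by their components in each chart, subject to the
   transformation law on overlaps: [metric c x] has entries g(d_i, d_j) and
   [acs c x] is the matrix of I in the coordinate frame. *)
Record almost_hermitian := AlmostHermitian {
  metric : chart M -> 'cV[R]_4 -> 'M[R]_4;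
  acs : chart M -> 'cV[R]_4 -> 'M[R]_4;
  metric_smooth : forall c, smooth_mx (img c) (metric c);
  metric_sym : forall c x, img c x -> (metric c x)^T = metric c x;
  metric_pos : forall c x, img c x -> forall u : 'cV[R]_4, u != 0 ->
    0 < (u^T *m metric c x *m u) 0 0;
  metric_change : forall c d x, overlap c d x ->
    metric c x = (jac (transition c d) x)^T *m metric d (transition c d x)
                 *m jac (transition c d) x;
  acs_smooth : forall c, smooth_mx (img c) (acs c);
  acs_change : forall c d x, overlap c d x ->
    jac (transition c d) x *m acs c x
    = acs d (transition c d x) *m jac (transition c d) x;
  acs_sqr : forall c x, img c x -> acs c x *m acs c x = - 1%:M;
  acs_isometry : forall c x, img c x ->
    (acs c x)^T *m metric c x *m acs c x = metric c x
}.

End Manifold.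

(** * Riemannian and almost Hermitian geometry in a chart *)

Section Chart.
Variable R : realType.

Local Notation V := 'cV[R]_4.
Local Notation field := (V -> V).

Implicit Types (G I : V -> 'M[R]_4) (X Y Z : field) (x : V).

(* the coordinate vector field d_i *)
Definition cframe (i : 'I_4) : field := fun=> evec R i.

Definition bracket X Y : field := fun x =>
  \col_k \sum_i (X x i 0 * partial i (fun y => Y y k 0) x
                 - Y x i 0 * partial i (fun y => X y k 0) x).

Definition christoffel G x (k i j : 'I_4) : R :=
  2^-1 * \sum_l invmx (G x) k l *
    (partial i (fun y => G y j l) x + partial j (fun y => G y i l) x
     - partial l (fun y => G y i j) x).

Definition levi_civita G X Y : field := fun x =>
  \col_k (\sum_i X x i 0 * partial i (fun y => Y y k 0) x
          + \sum_i \sum_j christoffel G x k i j * X x i 0 * Y x j 0).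

Definition apply_end I X : field := fun x => I x *m X x.

(* (nabla_X I) Y *)
Definition nabla_end G I X Y : field := fun x =>
  levi_civita G X (apply_end I Y) x - apply_end I (levi_civita G X Y) x.

Definition canonical_connection G I X Y : field := fun x =>
  levi_civita G X Y x + 2^-1 *: nabla_end G I X (apply_end I Y) x.

(* Note the sign: R(X, Y) = - [D_X, D_Y] + D_[X, Y]. *)
Definition curvature (D : field -> field -> field) X Y Z : field := fun x =>
  - (D X (D Y Z) x - D Y (D X Z) x) + D (bracket X Y) Z x.

Definition inner G x (u v : V) : R := (u^T *m G x *m v) 0 0.

(* 2-forms at a point are skew matrices (alpha(d_a, d_b))_ab; the operations
   below are the usual index formulas and are meant for skew matrices. *)

Definition kahler_form G I x : 'M[R]_4 :=
  \matrix_(a, b) inner G x (I x *m evec R a) (evec R b).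

Definition curvature_form G (D : field -> field -> field) X Y x : 'M[R]_4 :=
  \matrix_(a, b) inner G x (curvature D X Y (cframe a) x) (evec R b).

(* alpha^{ab} = g^{ac} g^{bd} alpha_cd *)
Definition raise G x (A : 'M[R]_4) : 'M[R]_4 :=
  \matrix_(a, b) \sum_c \sum_d invmx (G x) a c * invmx (G x) b d * A c d.

(* The factor 1/2 makes e^i /\ e^j, i < j, orthonormal. *)
Definition inner2 G x (A B : 'M[R]_4) : R :=
  2^-1 * \sum_a \sum_b raise G x A a b * B a b.

(* the Riemannian volume form evaluated on the coordinate frame, for the
   orientation sign [o] *)
Definition volume G (o : R) x (a b c d : 'I_4) : R :=
  o * Num.sqrt (\det (G x)) *
  \det (\matrix_(i < 4, j < 4) (tnth [tuple a; b; c; d] i == j)%:R : 'M[R]_4).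

Definition hodge G (o : R) x (A : 'M[R]_4) : 'M[R]_4 :=
  \matrix_(c, d) (2^-1 * \sum_a \sum_b raise G x A a b * volume G o x a b c d).

Definition asd_part G (o : R) x (A : 'M[R]_4) : 'M[R]_4 :=
  2^-1 *: (A - hodge G o x A).

Definition chern_form G I X Y x : R :=
  inner2 G x (curvature_form G (canonical_connection G I) X Y x)
             (kahler_form G I x).

(* With the sign convention of [curvature], Ric(X, Y) is the trace of
   Z |-> R(X, Z) Y; it is positive on round spheres. *)
Definition ricci G X Y x : R :=
  \sum_k curvature (levi_civita G) X (cframe k) Y x k 0.

Definition ric G x (a b : 'I_4) : R := ricci G (cframe a) (cframe b) x.

Definition scalar_curvature G x : R :=
  \sum_a \sum_b invmx (G x) a b * ric G x a b.

Definition riem G x (a b c d : 'I_4) : R :=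
  curvature_form G (levi_civita G) (cframe a) (cframe b) x c d.

(* the Weyl tensor in dimension 4; R_abab is a positive multiple of the
   sectional curvature *)
Definition weyl G x (a b c d : 'I_4) : R :=
  riem G x a b c d
  - 2^-1 * (G x a c * ric G x b d - G x a d * ric G x b c
            + G x b d * ric G x a c - G x b c * ric G x a d)
  + scalar_curvature G x / 6 * (G x a c * G x b d - G x a d * G x b c).

Definition weyl_op G x (A : 'M[R]_4) : 'M[R]_4 :=
  \matrix_(c, d) (2^-1 * \sum_a \sum_b raise G x A a b * weyl G x a b c d).

Definition weyl_minus G (o : R) x (A : 'M[R]_4) : 'M[R]_4 :=
  asd_part G o x (weyl_op G x (asd_part G o x A)).

End Chart.

(** * The global conditions *)

Section Conditions.
Variables (R : realType) (M : manifold4 R) (H : almost_hermitian M).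

Definition kahler_selfdual (o : orientation M) : Prop :=
  forall (c : chart M) x, img c x ->
    hodge (metric H c) (o c x) x (kahler_form (metric H c) (acs H c) x)
    = kahler_form (metric H c) (acs H c) x.

(* curvature of the canonical connection = 1/2 gamma_1 (x) omega_I, tested on
   arbitrary vector fields X, Y, Z, W over chart domains *)
Definition curvature_generated_by_kahler : Prop :=
  forall (c : chart M) (X Y Z W : 'cV[R]_4 -> 'cV[R]_4),
    smooth_mx (img c) X -> smooth_mx (img c) Y ->
    smooth_mx (img c) Z -> smooth_mx (img c) W ->
    forall x, img c x ->
      inner (metric H c) x
        (curvature (canonical_connection (metric H c) (acs H c)) X Y Z x) (W x)
      = 2^-1 * chern_form (metric H c) (acs H c) X Y x
        * inner (metric H c) x (acs H c x *m Z x) (W x).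

Definition ricci_flat : Prop :=
  forall (c : chart M) (X Y : 'cV[R]_4 -> 'cV[R]_4),
    smooth_mx (img c) X -> smooth_mx (img c) Y ->
    forall x, img c x -> ricci (metric H c) X Y x = 0.

Definition weyl_minus_zero (o : orientation M) : Prop :=
  forall (c : chart M) x, img c x ->
    forall A : 'M[R]_4, A^T = - A ->
      weyl_minus (metric H c) (o c x) x A = 0.

End Conditions.

(* Main.v *)
Require Import Defs.
From mathcomp Require Import all_boot all_order all_algebra.
From mathcomp Require Import fingroup perm.
From mathcomp Require Import all_classical all_reals.
From mathcomp Require Import topology normedtype derive.
From mathcomp Require Import ring lra.

Set Implicit Arguments.
Unset Strict Implicit.
Unset Printing Implicit Defensive.

Import Order.TTheory GRing.Theory Num.Theory.
Import numFieldNormedType.Exports.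

Local Open Scope classical_set_scope.
Local Open Scope ring_scope.

(** The condition is pointwise. In a chart the canonical connection has coefficient
    matrices C~_i = C_i - I (nabla_i I) / 2, where C_i are the Christoffel matrices, and
    its curvature is
      R~(X, Y) = (R(X, Y) - I R(X, Y) I) / 2 + [nabla_X I, nabla_Y I] / 4.
    The endomorphisms nabla_X I are skew and anticommute with I, so their commutators
    are multiples of I, while the part of a skew endomorphism commuting with I is
    spanned by I and its anti-selfdual component. Hence R~ is generated by the Kaehler
    form iff every 2-form R(X, Y) is selfdual. In an orthonormal frame adapted to I the
    latter is a linear system on the 20 components of an algebraic curvature tensor,
    equivalent to Ric = 0 together with the vanishing of the anti-selfdual block of R,
    and that block is W^- once Ric = 0. *)

(** * Symmetry of second derivatives *)

Lemma dist_lt_add (R : realDomainType) (a b z e : R) :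
  `|a - z| < e -> `|b - z| < e -> `|a - b| < e + e.
Proof.
move=> az bz; rewrite -(subrKA z a (- b)).
by apply: (le_lt_trans (ler_normD _ _)); apply: ltrD => //; rewrite distrC.
Qed.

Section MixedPartials.
Variables (R : realType) (V : normedModType R).
Implicit Types (f : V -> R) (p v w : V).

Lemma is_derive_line f p v (a : R) : derivable f (a *: v + p) v ->
  is_derive a 1 (fun t : R => f (t *: v + p)) ('D_v f (a *: v + p)).
Proof.
have E : (fun h : R => h^-1 *: (((fun t : R => f (t *: v + p)) \o shift a) (h *: 1)
                                - f (a *: v + p))) =
         (fun h : R => h^-1 *: ((f \o shift (a *: v + p)) (h *: v)
                                - f (a *: v + p))).
  apply/funext => h /=; congr (_ *: (f _ - _)).
  by rewrite [h *: 1]mulr1 scalerDl addrA.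
move=> df; apply: DeriveDef; first by rewrite /derivable E.
by rewrite /derive E.
Qed.

Lemma MVT_line f p v (t : R) : 0 < t ->
  (forall a, 0 <= a <= t -> derivable f (a *: v + p) v) ->
  exists2 c, 0 < c < t & f (t *: v + p) - f p = t * 'D_v f (c *: v + p).
Proof.
move=> t0 df.
have [] := @MVT R (fun a => f (a *: v + p)) (fun a => 'D_v f (a *: v + p)) 0 t t0.
- move=> a; rewrite in_itv /= => /andP[a0 at1].
  by apply: is_derive_line; apply: df; rewrite !ltW.
- apply: derivable_within_continuous => a; rewrite in_itv /= => ha.
  by have [] := is_derive_line (df _ ha).
move=> c; rewrite in_itv /= => hc; rewrite scale0r add0r subr0 => E.
by exists c => //; rewrite E mulrC.
Qed.

Lemma second_difference f (U : set V) p v w (h : R) : 0 < h ->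
  (forall a b, 0 <= a <= h -> 0 <= b <= h -> U (a *: v + b *: w + p)) ->
  (forall y, U y -> derivable f y v) ->
  (forall y, U y -> derivable (fun z => 'D_v f z) y w) ->
  exists a b, [/\ 0 <= a <= h, 0 <= b <= h &
    f (h *: v + h *: w + p) - f (h *: v + p) - f (h *: w + p) + f p =
    h ^+ 2 * 'D_w (fun z => 'D_v f z) (a *: v + b *: w + p)].
Proof.
move=> h0 UP dv dw.
have hh : 0 <= h <= h by rewrite ltW /=.
have h00 : 0 <= (0 : R) <= h by rewrite lexx ltW.
pose F := (f \o shift (h *: w)) \- f.
have dF a : 0 <= a <= h -> is_derive (a *: v + p) v F
    ('D_v f (h *: w + (a *: v + p)) - 'D_v f (a *: v + p)).
  move=> ha.
  have U0 : U (a *: v + p) by have := UP a 0 ha h00; rewrite scale0r addr0.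
  have U1 : U (h *: w + (a *: v + p)).
    by have := UP a h ha hh; rewrite addrCA addrA.
  apply: is_deriveB; last exact/derivableP/dv.
  have E : (fun k : R => k^-1 *: (((f \o shift (h *: w)) \o shift (a *: v + p)) (k *: v)
                                  - (f \o shift (h *: w)) (a *: v + p))) =
           (fun k : R => k^-1 *: ((f \o shift (h *: w + (a *: v + p))) (k *: v)
                                  - f (h *: w + (a *: v + p)))).
    apply/funext => k /=; congr (_ *: (f _ - f _)); last by rewrite addrC.
    by rewrite -addrA [a *: v + p + _]addrC.
  by apply: DeriveDef; rewrite /derivable /derive E //; apply: dv.
have [c hc Fc] : exists2 c, 0 < c < h &
    F (h *: v + p) - F p = h * 'D_v F (c *: v + p).
  by apply: MVT_line => // a /dF [].
have {}hc : 0 <= c <= h by case/andP: hc => ? ?; rewrite !ltW.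
have [d hd Fd] : exists2 d, 0 < d < h &
    'D_v f (h *: w + (c *: v + p)) - 'D_v f (c *: v + p)
    = h * 'D_w (fun z => 'D_v f z) (d *: w + (c *: v + p)).
  apply: (@MVT_line (fun z => 'D_v f z)) => // b hb.
  by apply: dw; have := UP c b hc hb; rewrite addrCA addrA.
have {}hd : 0 <= d <= h by case/andP: hd => ? ?; rewrite !ltW.
exists c, d; split; [exact: hc|exact: hd|].
have -> : c *: v + d *: w + p = d *: w + (c *: v + p) by rewrite addrCA addrA.
rewrite expr2 -mulrA -Fd.
have [_ <-] := dF c hc; rewrite -Fc /F /=.
have -> : h *: v + h *: w + p = h *: v + p + h *: w by rewrite addrAC.
by rewrite [p + h *: w]addrC opprB addrCA !addrA; ring.
Qed.

Lemma derive_commute f (U : set V) p v w : open U -> U p ->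
  (forall y, U y -> derivable f y v) -> (forall y, U y -> derivable f y w) ->
  (forall y, U y -> derivable (fun z => 'D_v f z) y w) ->
  (forall y, U y -> derivable (fun z => 'D_w f z) y v) ->
  {for p, continuous (fun y => 'D_w (fun z => 'D_v f z) y)} ->
  {for p, continuous (fun y => 'D_v (fun z => 'D_w f z) y)} ->
  'D_w (fun z => 'D_v f z) p = 'D_v (fun z => 'D_w f z) p.
Proof.
move=> oU Up dv dw dvw dwv cvw cwv.
apply/eqP/negPn/negP => ne.
set A := fun y => 'D_w (fun z => 'D_v f z) y in cvw *.
set B := fun y => 'D_v (fun z => 'D_w f z) y in cwv *.
pose e := `|A p - B p| / 2.
have e0 : 0 < e by rewrite divr_gt0 // normr_gt0 subr_eq0.
have nA : \forall y \near p, `|A p - A y| < e by move/cvgr_dist_lt : cvw; apply.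
have nB : \forall y \near p, `|B p - B y| < e by move/cvgr_dist_lt : cwv; apply.
have nU : \forall y \near p, U y by apply: open_nbhs_nbhs.
have [r /= r0 rP] := (nbhs_normP _ _).1 (filterI (filterI nA nB) nU).
pose h := r / (2 * (`|v| + `|w| + 1)).
have vw : 0 < `|v| + `|w| + 1.
  by rewrite ltr_wpDl // addr_ge0.
have h0 : 0 < h by rewrite divr_gt0 // mulr_gt0.
have near a b : 0 <= a <= h -> 0 <= b <= h ->
    (`|A p - A (a *: v + b *: w + p)| < e /\ `|B p - B (a *: v + b *: w + p)| < e)
    /\ U (a *: v + b *: w + p).
  move=> /andP[a0 ah] /andP[b0 bh]; apply: rP => /=.
  rewrite /ball_ /= opprD addrCA subrr addr0 normrN.
  apply: (le_lt_trans (ler_normD _ _)).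
  rewrite !normrZ (ger0_norm a0) (ger0_norm b0).
  apply: (@le_lt_trans _ _ (h * `|v| + h * `|w|)).
    by apply: lerD; apply: ler_wpM2r.
  have E : r = h * (2 * (`|v| + `|w| + 1)).
    by rewrite /h divfK // gt_eqF // mulr_gt0.
  rewrite [X in _ < X]E -mulrDr ltr_pM2l //.
  by rewrite mulr_natl mulr2n ltr_pwDr // lerDl.
have [a [b [ha hb Eab]]] : exists a b, [/\ 0 <= a <= h, 0 <= b <= h &
    f (h *: v + h *: w + p) - f (h *: v + p) - f (h *: w + p) + f p =
    h ^+ 2 * A (a *: v + b *: w + p)].
  by apply: (@second_difference _ U) => // a b ha hb; case: (near a b ha hb).
have [c [d [hc hd Ecd]]] : exists c d, [/\ 0 <= c <= h, 0 <= d <= h &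
    f (h *: w + h *: v + p) - f (h *: w + p) - f (h *: v + p) + f p =
    h ^+ 2 * B (c *: w + d *: v + p)].
  apply: (@second_difference _ U) => // a' b' ha' hb'.
  by rewrite [a' *: w + _]addrC; case: (near b' a' hb' ha').
have [[lA _] _] := near a b ha hb.
have [[_ lB] _] := near d c hd hc.
move: Ecd; rewrite [h *: w + h *: v]addrC [c *: w + _]addrC => Ecd.
have h2 : h ^+ 2 != 0 by rewrite expf_neq0 // gt_eqF.
have AB : A (a *: v + b *: w + p) = B (d *: v + c *: w + p).
  have swap (x1 x2 x3 x4 : R) : x1 - x2 - x3 + x4 = x1 - x3 - x2 + x4.
    by rewrite [_ - _ - _]addrAC.
  by apply: (mulfI h2); rewrite -Eab -Ecd; apply: swap.
move: lA lB; rewrite AB; set z := B _ => lA lB.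
have := dist_lt_add lA lB.
by rewrite /e -splitr ltxx.
Qed.

End MixedPartials.

(** * Smooth functions and matrices *)

Section SmoothFunctions.
Variables (R : realType) (U : set 'cV[R]_4).
Hypothesis oU : open U.
Implicit Types (f g : 'cV[R]_4 -> R) (x : 'cV[R]_4) (i j : 'I_4).

Lemma near_eq_on (T : Type) (f g : 'cV[R]_4 -> T) x : U x ->
  (forall y, U y -> f y = g y) -> \forall y \near x, f y = g y.
Proof. by move=> Ux fg; apply: filterS (open_nbhs_nbhs (conj oU Ux)). Qed.

Lemma eq_partial f g i x : U x -> (forall y, U y -> f y = g y) ->
  partial i f x = partial i g x.
Proof. by move=> Ux fg; apply: near_eq_derive; apply: near_eq_on. Qed.

Lemma eq_continuous_on f g : (forall y, U y -> f y = g y) ->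
  (forall x, U x -> {for x, continuous f}) -> forall x, U x -> {for x, continuous g}.
Proof.
move=> fg cf x Ux; have /= := cf x Ux; rewrite /prop_for /continuous_at (fg x Ux) => cfx.
by apply: cvg_trans cfx; exact: near_eq_cvg (near_eq_on Ux fg).
Qed.

Lemma eq_Cn n f g : (forall y, U y -> f y = g y) -> Cn n U f -> Cn n U g.
Proof.
elim: n f g => [|n IH] f g fg [cf df]; split=> //.
- exact: eq_continuous_on fg cf.
- exact: eq_continuous_on fg cf.
move=> i; have [di ci] := df i; split=> [x Ux|].
  by apply: near_eq_derivable (di x Ux); apply: near_eq_on.
by apply: IH ci => y Uy; apply: eq_partial.
Qed.

Lemma Cn_cont n f x : Cn n U f -> U x -> {for x, continuous f}.
Proof. by case: n => [|n] [cf _] Ux; apply: cf. Qed.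

Lemma CnW n f : Cn n.+1 U f -> Cn n U f.
Proof.
elim: n f => [|n IH] f [cf df]; split=> // i.
by have [di ci] := df i; split=> //; apply: IH.
Qed.

Lemma Cn_cst n (a : R) : Cn n U (fun=> a).
Proof.
elim: n a => [|n IH] a; split=> //; try by move=> x _; exact: cst_continuous.
move=> i; split=> [x _|]; first exact: derivable_cst.
by apply: eq_Cn (IH 0) => y _; rewrite /partial derive_cst.
Qed.

Lemma CnD n f g : Cn n U f -> Cn n U g -> Cn n U (fun x => f x + g x).
Proof.
elim: n f g => [|n IH] f g [cf df] [cg dg]; split=> //.
- by move=> x Ux; apply: continuousD; [apply: cf|apply: cg].
- by move=> x Ux; apply: continuousD; [apply: cf|apply: cg].
move=> i; have [dfi cfi] := df i; have [dgi cgi] := dg i; split=> [x Ux|].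
  by apply: derivableD; [apply: dfi|apply: dgi].
apply: eq_Cn (IH _ _ cfi cgi) => y Uy.
by rewrite /partial (deriveD (dfi y Uy) (dgi y Uy)).
Qed.

Lemma CnM n f g : Cn n U f -> Cn n U g -> Cn n U (fun x => f x * g x).
Proof.
elim: n f g => [|n IH] f g Cf Cg; have [cf df] := Cf; have [cg dg] := Cg; split=> //.
- by move=> x Ux; apply: continuousM; [apply: cf|apply: cg].
- by move=> x Ux; apply: continuousM; [apply: cf|apply: cg].
move=> i; have [dfi cfi] := df i; have [dgi cgi] := dg i; split=> [x Ux|].
  by apply: derivableM; [apply: dfi|apply: dgi].
apply: eq_Cn (CnD (IH _ _ (CnW Cf) cgi) (IH _ _ (CnW Cg) cfi)) => y Uy.
by rewrite /partial (deriveM (dfi y Uy) (dgi y Uy)).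
Qed.

Lemma CnV n f : (forall x, U x -> f x != 0) -> Cn n U f ->
  Cn n U (fun x => (f x)^-1).
Proof.
move=> f0; elim: n => [|n IH] Cf; have [cf df] := Cf; split=> //.
- by move=> x Ux; apply: continuousV; [apply: f0|apply: cf].
- by move=> x Ux; apply: continuousV; [apply: f0|apply: cf].
move=> i; have [dfi cfi] := df i; split=> [x Ux|].
  by apply: derivableV; [apply: f0|apply: dfi].
have CV := IH (CnW Cf).
apply: eq_Cn (CnM (Cn_cst n (-1)) (CnM (CnM CV CV) cfi)) => y Uy.
by rewrite /partial (deriveV (f0 y Uy) (dfi y Uy)) -exprVn expr2 mulN1r scaleNr.
Qed.

Lemma smooth_derivable f i x : smooth U f -> U x -> derivable f x (evec R i).
Proof. by move=> /(_ 1%N) [_ /(_ i)[d _]]; apply: d. Qed.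

Lemma smooth_partial f i : smooth U f -> smooth U (partial i f).
Proof. by move=> sf n; have [_ /(_ i)[]] := sf n.+1. Qed.

Lemma eq_smooth f g : (forall y, U y -> f y = g y) -> smooth U f -> smooth U g.
Proof. by move=> fg sf n; apply: eq_Cn (sf n). Qed.

Lemma smooth_cst (a : R) : smooth U (fun=> a).
Proof. by move=> n; apply: Cn_cst. Qed.

Lemma smoothD f g : smooth U f -> smooth U g -> smooth U (fun x => f x + g x).
Proof. by move=> sf sg n; apply: CnD. Qed.

Lemma smoothM f g : smooth U f -> smooth U g -> smooth U (fun x => f x * g x).
Proof. by move=> sf sg n; apply: CnM. Qed.

Lemma smoothN f : smooth U f -> smooth U (fun x => - f x).
Proof.
move=> sf; apply: eq_smooth (smoothM (smooth_cst (-1)) sf) => y _.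
by rewrite mulN1r.
Qed.

Lemma smoothV f : (forall x, U x -> f x != 0) -> smooth U f ->
  smooth U (fun x => (f x)^-1).
Proof. by move=> f0 sf n; apply: CnV. Qed.

Lemma smooth_sum (T : Type) (r : seq T) (P : pred T) (F : T -> 'cV[R]_4 -> R) :
  (forall t, smooth U (F t)) -> smooth U (fun x => \sum_(t <- r | P t) F t x).
Proof.
move=> sF; elim: r => [|t r IH].
  by apply: eq_smooth (smooth_cst 0) => y _; rewrite big_nil.
case Pt: (P t).
  by apply: eq_smooth (smoothD (sF t) IH) => y _; rewrite big_cons Pt.
by apply: eq_smooth IH => y _; rewrite big_cons Pt.
Qed.

Lemma smooth_prod (T : Type) (r : seq T) (P : pred T) (F : T -> 'cV[R]_4 -> R) :
  (forall t, smooth U (F t)) -> smooth U (fun x => \prod_(t <- r | P t) F t x).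
Proof.
move=> sF; elim: r => [|t r IH].
  by apply: eq_smooth (smooth_cst 1) => y _; rewrite big_nil.
case Pt: (P t).
  by apply: eq_smooth (smoothM (sF t) IH) => y _; rewrite big_cons Pt.
by apply: eq_smooth IH => y _; rewrite big_cons Pt.
Qed.

Lemma partialD f g i x : smooth U f -> smooth U g -> U x ->
  partial i (fun y => f y + g y) x = partial i f x + partial i g x.
Proof. by move=> sf sg Ux; apply: deriveD; apply: smooth_derivable. Qed.

Lemma partialM f g i x : smooth U f -> smooth U g -> U x ->
  partial i (fun y => f y * g y) x = partial i f x * g x + f x * partial i g x.
Proof.
move=> sf sg Ux; rewrite /partial.
have -> := @deriveM R _ f g x (evec R i) (smooth_derivable sf Ux) (smooth_derivable sg Ux).
by rewrite addrC [g x *: _]mulrC.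
Qed.

Lemma partial_cst (a : R) i x : partial i (fun=> a) x = 0.
Proof. exact: derive_cst. Qed.

Lemma partial_sum (T : Type) (r : seq T) (F : T -> 'cV[R]_4 -> R) i x :
  (forall t, smooth U (F t)) -> U x ->
  partial i (fun y => \sum_(t <- r) F t y) x = \sum_(t <- r) partial i (F t) x.
Proof.
move=> sF Ux; elim: r => [|t r IH].
  rewrite big_nil -[RHS](partial_cst 0 i x).
  by apply: (@eq_partial _ _ i x Ux) => y _; rewrite big_nil.
rewrite big_cons -IH -partialD //; last exact: smooth_sum.
by apply: (@eq_partial _ _ i x Ux) => y _; rewrite big_cons.
Qed.

Lemma partialC f i j x : smooth U f -> U x ->
  partial i (partial j f) x = partial j (partial i f) x.
Proof.
move=> sf Ux; apply: (@derive_commute R _ f U x (evec R j) (evec R i)) => //.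
- by move=> y Uy; apply: smooth_derivable.
- by move=> y Uy; apply: smooth_derivable.
- by move=> y Uy; apply: (smooth_derivable (smooth_partial j sf)).
- by move=> y Uy; apply: (smooth_derivable (smooth_partial i sf)).
- exact: (Cn_cont (smooth_partial i (smooth_partial j sf) 0%N) Ux).
- exact: (Cn_cont (smooth_partial j (smooth_partial i sf) 0%N) Ux).
Qed.

End SmoothFunctions.

Definition pd (R : realType) (m n : nat) (i : 'I_4)
    (F : 'cV[R]_4 -> 'M[R]_(m, n)) (x : 'cV[R]_4) : 'M[R]_(m, n) :=
  \matrix_(a, b) partial i (fun y => F y a b) x.


Section SmoothMatrices.
Variables (R : realType) (U : set 'cV[R]_4).
Hypothesis oU : open U.
Implicit Types (x : 'cV[R]_4) (i j : 'I_4).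

Lemma eq_pd m n (F G : 'cV[R]_4 -> 'M[R]_(m, n)) i x : U x ->
  (forall y, U y -> F y = G y) -> pd i F x = pd i G x.
Proof.
move=> Ux FG; apply/matrixP => a b; rewrite !mxE.
by apply: (eq_partial oU) => // y Uy; rewrite FG.
Qed.

Lemma eq_smooth_mx m n (F G : 'cV[R]_4 -> 'M[R]_(m, n)) :
  (forall y, U y -> F y = G y) -> smooth_mx U F -> smooth_mx U G.
Proof. by move=> FG sF a b; apply: (eq_smooth oU) (sF a b) => y Uy; rewrite FG. Qed.

Lemma smooth_mx_cst m n (A : 'M[R]_(m, n)) : smooth_mx U (fun=> A).
Proof. by move=> a b; apply: smooth_cst. Qed.

Lemma smooth_pd m n (F : 'cV[R]_4 -> 'M[R]_(m, n)) i :
  smooth_mx U F -> smooth_mx U (pd i F).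
Proof.
move=> sF a b; apply: (eq_smooth oU) (smooth_partial i (sF a b)) => y _.
by rewrite mxE.
Qed.

Lemma smooth_mxD m n (F G : 'cV[R]_4 -> 'M[R]_(m, n)) :
  smooth_mx U F -> smooth_mx U G -> smooth_mx U (fun x => F x + G x).
Proof.
move=> sF sG a b; apply: (eq_smooth oU) (smoothD oU (sF a b) (sG a b)) => y _.
by rewrite mxE.
Qed.

Lemma smooth_mxM m n p (F : 'cV[R]_4 -> 'M[R]_(m, n)) (G : 'cV[R]_4 -> 'M[R]_(n, p)) :
  smooth_mx U F -> smooth_mx U G -> smooth_mx U (fun x => F x *m G x).
Proof.
move=> sF sG a b.
apply: (eq_smooth oU) (smooth_sum oU _ _ (fun k => smoothM oU (sF a k) (sG k b))) => y _.
by rewrite mxE.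
Qed.

Lemma smooth_mxZ m n (f : 'cV[R]_4 -> R) (F : 'cV[R]_4 -> 'M[R]_(m, n)) :
  smooth U f -> smooth_mx U F -> smooth_mx U (fun x => f x *: F x).
Proof.
move=> sf sF a b; apply: (eq_smooth oU) (smoothM oU sf (sF a b)) => y _.
by rewrite mxE.
Qed.

Lemma smooth_mx_sum m n (T : Type) (r : seq T) (F : T -> 'cV[R]_4 -> 'M[R]_(m, n)) :
  (forall t, smooth_mx U (F t)) -> smooth_mx U (fun x => \sum_(t <- r) F t x).
Proof.
move=> sF a b.
apply: (eq_smooth oU) (smooth_sum oU r predT (fun t => sF t a b)) => y _.
by rewrite summxE.
Qed.

Lemma smooth_det n (F : 'cV[R]_4 -> 'M[R]_n) :
  smooth_mx U F -> smooth U (fun x => \det (F x)).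
Proof.
move=> sF; apply: smooth_sum => // s; apply: smoothM => //; first exact: smooth_cst.
by apply: smooth_prod => // k; apply: sF.
Qed.

Lemma smooth_invmx n (F : 'cV[R]_4 -> 'M[R]_n) :
  (forall x, U x -> F x \in unitmx) -> smooth_mx U F ->
  smooth_mx U (fun x => invmx (F x)).
Proof.
move=> uF sF.
have sadj : smooth_mx U (fun x => \adj (F x)).
  move=> a b.
  apply: (eq_smooth oU) (smoothM oU (smooth_cst oU ((-1) ^+ (b + a)))
    (smooth_det (F := fun x => row' b (col' a (F x))) _)) => [y _|c d].
    by rewrite mxE.
  by apply: (eq_smooth oU) (sF (lift b c) (lift a d)) => y _; rewrite !mxE.
have sdet : smooth U (fun x => (\det (F x))^-1).
  apply: (smoothV oU) (smooth_det sF) => x Ux.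
  by have := uF x Ux; rewrite unitmxE unitfE.
apply: eq_smooth_mx (smooth_mxZ sdet sadj) => y Uy.
by rewrite /invmx uF.
Qed.

Lemma pd_cst m n (A : 'M[R]_(m, n)) i x : pd i (fun=> A) x = 0.
Proof. by apply/matrixP => a b; rewrite !mxE partial_cst. Qed.

Lemma pdD m n (F G : 'cV[R]_4 -> 'M[R]_(m, n)) i x :
  smooth_mx U F -> smooth_mx U G -> U x ->
  pd i (fun y => F y + G y) x = pd i F x + pd i G x.
Proof.
move=> sF sG Ux; apply/matrixP => a b; rewrite !mxE -(partialD i (sF a b) (sG a b) Ux).
by apply: (eq_partial oU) => // y _; rewrite mxE.
Qed.

Lemma pdM m n p (F : 'cV[R]_4 -> 'M[R]_(m, n)) (G : 'cV[R]_4 -> 'M[R]_(n, p)) i x :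
  smooth_mx U F -> smooth_mx U G -> U x ->
  pd i (fun y => F y *m G y) x = pd i F x *m G x + F x *m pd i G x.
Proof.
move=> sF sG Ux; apply/matrixP => a b; rewrite !mxE -big_split /=.
under eq_bigr => k _ do rewrite !mxE -(partialM i (sF a k) (sG k b) Ux).
rewrite -(partial_sum oU _ _ (fun k => smoothM oU (sF a k) (sG k b)) Ux).
by apply: (eq_partial oU) => // y _; rewrite mxE.
Qed.

Lemma pdZ m n (f : 'cV[R]_4 -> R) (F : 'cV[R]_4 -> 'M[R]_(m, n)) i x :
  smooth U f -> smooth_mx U F -> U x ->
  pd i (fun y => f y *: F y) x = partial i f x *: F x + f x *: pd i F x.
Proof.
move=> sf sF Ux; apply/matrixP => a b; rewrite !mxE -(partialM i sf (sF a b) Ux).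
by apply: (eq_partial oU) => // y _; rewrite mxE.
Qed.

Lemma pdZc m n (k : R) (F : 'cV[R]_4 -> 'M[R]_(m, n)) i x :
  smooth_mx U F -> U x -> pd i (fun y => k *: F y) x = k *: pd i F x.
Proof.
move=> sF Ux; rewrite (pdZ i (smooth_cst oU k) sF Ux).
by rewrite partial_cst scale0r add0r.
Qed.

Lemma smooth_mxN m n (F : 'cV[R]_4 -> 'M[R]_(m, n)) :
  smooth_mx U F -> smooth_mx U (fun x => - F x).
Proof.
move=> sF; apply: eq_smooth_mx (smooth_mxZ (smooth_cst oU (-1)) sF) => y _.
by rewrite scaleN1r.
Qed.

Lemma pdN m n (F : 'cV[R]_4 -> 'M[R]_(m, n)) i x :
  smooth_mx U F -> U x -> pd i (fun y => - F y) x = - pd i F x.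
Proof.
move=> sF Ux; rewrite -scaleN1r -(pdZc _ _ sF Ux).
by apply: eq_pd => // y _; rewrite scaleN1r.
Qed.

Lemma pd_sum m n (T : Type) (r : seq T) (F : T -> 'cV[R]_4 -> 'M[R]_(m, n)) i x :
  (forall t, smooth_mx U (F t)) -> U x ->
  pd i (fun y => \sum_(t <- r) F t y) x = \sum_(t <- r) pd i (F t) x.
Proof.
move=> sF Ux; apply/matrixP => a b; rewrite !mxE summxE.
under eq_bigr => t _ do rewrite mxE.
rewrite -(partial_sum oU r _ (fun t => sF t a b) Ux).
by apply: (eq_partial oU) => // y _; rewrite summxE.
Qed.

Lemma pd_tr m n (F : 'cV[R]_4 -> 'M[R]_(m, n)) i x :
  pd i (fun y => (F y)^T) x = (pd i F x)^T.
Proof.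
apply/matrixP => a b; rewrite !mxE; congr (partial i _ x).
by apply/funext => y; rewrite mxE.
Qed.

Lemma pdC m n (F : 'cV[R]_4 -> 'M[R]_(m, n)) i j x : smooth_mx U F -> U x ->
  pd i (pd j F) x = pd j (pd i F) x.
Proof.
move=> sF Ux; apply/matrixP => a b; rewrite [LHS]mxE [RHS]mxE.
have L k l : partial k (fun y => pd l F y a b) x
             = partial k (partial l (fun y => F y a b)) x.
  by congr (partial k _ x); apply/funext => y; rewrite mxE.
exact: etrans (L i j) (etrans (partialC oU i j (sF a b) Ux) (esym (L j i))).
Qed.

End SmoothMatrices.

(** * Curvature of connections in a chart *)

Section MatrixEntries.
Variables (R : realType) (m n : nat).
Implicit Types (A B : 'M[R]_(m, n)).

Lemma addmxE A B a b : (A + B) a b = A a b + B a b. Proof. by rewrite mxE. Qed.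
Lemma oppmxE A a b : (- A) a b = - A a b. Proof. by rewrite mxE. Qed.
Lemma scalemxE k A a b : (k *: A) a b = k * A a b. Proof. by rewrite mxE. Qed.
Lemma trmxE A a b : A^T a b = A b a. Proof. by rewrite mxE. Qed.

End MatrixEntries.

Definition linmxE := (addmxE, oppmxE, scalemxE, trmxE).

Section MatrixIdentities.
Variables (R : realType) (n : nat).

(* [ci], [di], [dicj] stand for C_i, d_i g and d_i C_j. *)
Lemma curvature_skew_alg (g ci cj di dj dicj djci : 'M[R]_n) :
  g^T = g -> di = g *m ci + (g *m ci)^T -> dj = g *m cj + (g *m cj)^T ->
  di *m cj + g *m dicj + (di *m cj + g *m dicj)^T
    = dj *m ci + g *m djci + (dj *m ci + g *m djci)^T ->
  (g *m - (dicj - djci + (ci *m cj - cj *m ci)))^T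
    = - (g *m - (dicj - djci + (ci *m cj - cj *m ci))).
Proof.
move=> gT Edi Edj; set A := di *m cj + _; set B := dj *m ci + _ => AB.
pose X := ci^T *m g *m cj.
have XT : X^T = cj^T *m g *m ci by rewrite /X !trmx_mul trmxK gT mulmxA.
have -> : g *m - (dicj - djci + (ci *m cj - cj *m ci)) = B - A + X - X^T.
  rewrite XT /A /B Edi Edj !mulmxDl !trmx_mul gT mulmxN !mulmxDr !mulmxN !mulmxA /X.
  move: (g *m dicj) (g *m djci) (g *m ci *m cj) (g *m cj *m ci) => a1 a2 a3 a4.
  move: (ci^T *m g *m cj) (cj^T *m g *m ci) => a5 a6.
  by apply/matrixP => k l; rewrite !linmxE; ring.
move: AB; move: A B X {XT Edi Edj} => A B X AB.
apply/matrixP => k l; move/matrixP: AB => /(_ k l); rewrite !linmxE.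
move: (A k l) (A l k) (B k l) (B l k) (X k l) (X l k) => {A B X}.
by move=> a1 a2 a3 a4 a5 a6 E; lra.
Qed.

Variables (I a b : 'M[R]_n).
Hypothesis sqI : I *m I = - 1%:M.
Hypothesis aI : a *m I = - (I *m a).
Hypothesis bI : b *m I = - (I *m b).

(* [a], [b], [d], [p], [q] stand for d_i I, d_j I, d_i d_j I, d_i C_j, d_j C_i, so
   that [Ji] is nabla_i I and [Ci] is C_i - I (nabla_i I) / 2. *)
Lemma canonical_curvature_alg (ci cj d p q : 'M[R]_n) :
  let K := - (p - q + (ci *m cj - cj *m ci)) in
  let Ji := a + ci *m I - I *m ci in
  let Jj := b + cj *m I - I *m cj in
  let Ci := 2^-1 *: (ci - I *m a - I *m ci *m I) in
  let Cj := 2^-1 *: (cj - I *m b - I *m cj *m I) in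
  - (2^-1 *: (p - (a *m b + I *m d) - ((a *m cj + I *m p) *m I + I *m cj *m a))
     - 2^-1 *: (q - (b *m a + I *m d) - ((b *m ci + I *m q) *m I + I *m ci *m b))
     + (Ci *m Cj - Cj *m Ci))
  = 2^-1 *: (K - I *m K *m I) + 4^-1 *: (Ji *m Jj - Jj *m Ji).
Proof.
move=> K Ji Jj Ci Cj; rewrite /K /Ji /Jj /Ci /Cj.
have II X : X *m I *m I = - X by rewrite -mulmxA sqI mulmxN mulmx1.
have XaI X : X *m a *m I = - (X *m I *m a) by rewrite -mulmxA aI mulmxN mulmxA.
have XbI X : X *m b *m I = - (X *m I *m b) by rewrite -mulmxA bI mulmxN mulmxA.
do !rewrite ?mulmxDl ?mulmxDr ?mulmxN ?mulNmx ?mulmxA -?scalemxAl -?scalemxAr.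
do !rewrite ?(aI, bI, XaI, XbI, II, sqI) ?mulNmx ?mulmxN ?mul1mx ?opprK.
apply/matrixP => k l; rewrite !linmxE.
by field.
Qed.

End MatrixIdentities.

Definition conn (R : realType) (C : 'I_4 -> 'cV[R]_4 -> 'M[R]_4)
    (X Y : 'cV[R]_4 -> 'cV[R]_4) (x : 'cV[R]_4) : 'cV[R]_4 :=
  \sum_i X x i 0 *: (pd i Y x + C i x *m Y x).

Definition curvmx (R : realType) (C : 'I_4 -> 'cV[R]_4 -> 'M[R]_4)
    (i j : 'I_4) (x : 'cV[R]_4) : 'M[R]_4 :=
  - (pd i (C j) x - pd j (C i) x + (C i x *m C j x - C j x *m C i x)).

Definition christoffel_mx (R : realType) (G : 'cV[R]_4 -> 'M[R]_4)
    (i : 'I_4) (x : 'cV[R]_4) : 'M[R]_4 :=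
  \matrix_(k, j) christoffel G x k i j.

Definition nabla_acs (R : realType) (G I : 'cV[R]_4 -> 'M[R]_4)
    (i : 'I_4) (x : 'cV[R]_4) : 'M[R]_4 :=
  pd i I x + christoffel_mx G i x *m I x - I x *m christoffel_mx G i x.

Definition canonical_mx (R : realType) (G I : 'cV[R]_4 -> 'M[R]_4)
    (i : 'I_4) (x : 'cV[R]_4) : 'M[R]_4 :=
  2^-1 *: (christoffel_mx G i x - I x *m pd i I x
           - I x *m christoffel_mx G i x *m I x).

Section Connections.
Variables (R : realType) (U : set 'cV[R]_4).
Hypothesis oU : open U.
Local Notation field := ('cV[R]_4 -> 'cV[R]_4).
Implicit Types (X Y Z : field) (x : 'cV[R]_4) (i j : 'I_4)
  (C : 'I_4 -> 'cV[R]_4 -> 'M[R]_4).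

Lemma smooth_conn C X Y : (forall i, smooth_mx U (C i)) ->
  smooth_mx U X -> smooth_mx U Y -> smooth_mx U (conn C X Y).
Proof.
move=> sC sX sY.
exact: (smooth_mx_sum oU _ (fun i => smooth_mxZ oU (sX i 0)
  (smooth_mxD oU (smooth_pd oU i sY) (smooth_mxM oU (sC i) sY)))).
Qed.

Lemma conn_conn C X Y Z x : (forall i, smooth_mx U (C i)) ->
  smooth_mx U Y -> smooth_mx U Z -> U x ->
  conn C X (conn C Y Z) x =
  \sum_i \sum_j (X x i 0 * partial i (fun y => Y y j 0) x)
    *: (pd j Z x + C j x *m Z x)
  + \sum_i \sum_j (X x i 0 * Y x j 0)
    *: (pd i (pd j Z) x + pd i (C j) x *m Z x
        + (C j x *m pd i Z x + C i x *m pd j Z x) + C i x *m C j x *m Z x).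
Proof.
move=> sC sY sZ Ux; rewrite -big_split /=; apply: eq_bigr => i _.
have sCZ j : smooth_mx U (fun y => C j y *m Z y) by exact: smooth_mxM.
have sW j : smooth_mx U (fun y => pd j Z y + C j y *m Z y).
  by apply: smooth_mxD => //; exact: smooth_pd.
rewrite (pd_sum oU _ i (fun j => smooth_mxZ oU (sY j 0) (sW j)) Ux).
rewrite [in X in _ + X]/conn mulmx_sumr -!big_split /= scaler_sumr.
apply: eq_bigr => j _.
rewrite (pdZ oU i (sY j 0) (sW j) Ux) (pdD oU i (smooth_pd oU j sZ) (sCZ j) Ux).
rewrite (pdM oU i (sC j) sZ Ux) -scalemxAr.
rewrite -!scalerA -!scalerDr; congr (_ *: _).
rewrite -addrA; congr (_ + _); rewrite -scalerDr; congr (_ *: _).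
rewrite mulmxDr mulmxA.
move: (pd i (pd j Z) x) (pd i (C j) x *m Z x) (C j x *m pd i Z x) => a1 a2 a3.
by move: (C i x *m pd j Z x) (C i x *m C j x *m Z x) => a4 a5; rewrite !addrA.
Qed.

Lemma conn_bracket C X Y Z x : conn C (bracket X Y) Z x =
  \sum_i \sum_j (X x i 0 * partial i (fun y => Y y j 0) x)
    *: (pd j Z x + C j x *m Z x)
  - \sum_i \sum_j (Y x i 0 * partial i (fun y => X y j 0) x)
    *: (pd j Z x + C j x *m Z x).
Proof.
rewrite [X in _ = X - _]exchange_big [X in _ = _ - X]exchange_big /= -sumrB.
apply: eq_bigr => j _; rewrite mxE scaler_suml -sumrB.
by apply: eq_bigr => i _; rewrite scalerBl.
Qed.

Lemma curvature_conn (D : field -> field -> field) C X Y Z x :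
  (forall X' Y' y, smooth_mx U Y' -> U y -> D X' Y' y = conn C X' Y' y) ->
  (forall i, smooth_mx U (C i)) ->
  smooth_mx U X -> smooth_mx U Y -> smooth_mx U Z -> U x ->
  curvature D X Y Z x =
  \sum_i \sum_j (X x i 0 * Y x j 0) *: (curvmx C i j x *m Z x).
Proof.
move=> DC sC sX sY sZ Ux.
have sD X' : smooth_mx U X' -> smooth_mx U (D X' Z).
  move=> sX'; apply: (eq_smooth_mx oU) (smooth_conn sC sX' sZ) => y Uy.
  by rewrite DC.
have DD X' Y' : smooth_mx U Y' -> D X' (D Y' Z) x = conn C X' (conn C Y' Z) x.
  move=> sY'; rewrite (DC _ _ _ (sD _ sY') Ux); apply: eq_bigr => i _.
  rewrite (DC _ _ _ sZ Ux); congr (_ *: (_ + _)).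
  by apply: (eq_pd oU _ Ux) => y Uy; apply: DC.
rewrite /curvature (DC _ _ _ sZ Ux) !DD // conn_bracket !conn_conn //.
have alg (a b c d : 'cV[R]_4) : - (a + b - (c + d)) + (a - c) = d - b.
  by apply/matrixP => k l; rewrite !mxE; ring.
rewrite alg [X in X - _]exchange_big /= -sumrB; apply: eq_bigr => i _.
rewrite -sumrB; apply: eq_bigr => j _.
rewrite [Y x j 0 * _]mulrC -scalerBr; congr (_ *: _).
rewrite /curvmx (pdC oU i j sZ Ux).
rewrite mulNmx !mulmxDl !mulNmx.
move: (pd i (C j) x *m Z x) (pd j (C i) x *m Z x) (C i x *m C j x *m Z x) => a1 a2 a3.
move: (C j x *m C i x *m Z x) (C j x *m pd i Z x) (C i x *m pd j Z x) => a4 a5 a6.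
by apply/matrixP => a b; rewrite !mxE; ring.
Qed.

Variables (G I : 'cV[R]_4 -> 'M[R]_4).
Hypothesis sG : smooth_mx U G.
Hypothesis uG : forall x, U x -> G x \in unitmx.
Hypothesis symG : forall x, U x -> (G x)^T = G x.
Hypothesis sI : smooth_mx U I.
Hypothesis sqI : forall x, U x -> I x *m I x = - 1%:M.
Hypothesis isoI : forall x, U x -> (I x)^T *m G x *m I x = G x.
Local Notation Gam := (christoffel_mx G).

Lemma levi_civita_conn X Y x : levi_civita G X Y x = conn Gam X Y x.
Proof.
apply/matrixP => k z; rewrite (ord1 z) !mxE summxE -big_split /=.
apply: eq_bigr => i _; rewrite !mxE mulrDr; congr (_ + _).
rewrite mulr_sumr; apply: eq_bigr => j _; rewrite !mxE.
by rewrite -mulrA mulrCA.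
Qed.

Lemma smooth_christoffel i : smooth_mx U (Gam i).
Proof.
move=> k j; have sV := smooth_invmx oU uG sG.
apply: (eq_smooth oU) (smoothM oU (smooth_cst oU 2^-1) (smooth_sum oU _ predT
  (fun l => smoothM oU (sV k l) (smoothD oU (smoothD oU (smooth_partial i (sG j l))
     (smooth_partial j (sG i l))) (smoothN oU (smooth_partial l (sG i j))))))) => y _.
by rewrite mxE.
Qed.

Lemma smooth_canonical_mx i : smooth_mx U (canonical_mx G I i).
Proof.
have sC := smooth_christoffel i.
apply: smooth_mxZ => //; first exact: smooth_cst.
apply: smooth_mxD => //; last first.
  by apply: smooth_mxN => //; apply: smooth_mxM => //; exact: smooth_mxM.
apply: smooth_mxD => //; apply: smooth_mxN => //; apply: smooth_mxM => //.
exact: smooth_pd.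
Qed.

Lemma canonical_connection_conn X Y x : smooth_mx U Y -> U x ->
  canonical_connection G I X Y x = conn (canonical_mx G I) X Y x.
Proof.
move=> sY Ux; rewrite /canonical_connection /nabla_end /apply_end !levi_civita_conn.
rewrite /conn mulmx_sumr -sumrB scaler_sumr -big_split /=; apply: eq_bigr => i _.
have IIY : I x *m (I x *m Y x) = - Y x by rewrite mulmxA sqI // mulNmx mul1mx.
rewrite IIY -scalemxAr -scalerBr scalerA [2^-1 * _]mulrC -scalerA.
rewrite -scalerDr; congr (_ *: _).
rewrite (eq_pd oU (F := fun y => I y *m (I y *m Y y)) (G := fun y => - Y y) i Ux); last first.
  by move=> y Uy; rewrite mulmxA sqI // mulNmx mul1mx.
rewrite (pdN oU i sY Ux) (pdM oU i sI sY Ux) /canonical_mx.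
rewrite !mulmxDr !mulmxA sqI // -!scalemxAl !mulmxDl !mulNmx.
rewrite ?mulmxN ?mul1mx ?mulNmx ?mul1mx ?mulmxN.
move: (pd i Y x) (Gam i x *m Y x) (I x *m pd i I x *m Y x) => a1 a2 a3.
move: (I x *m Gam i x *m I x *m Y x) => a4.
by apply/matrixP => a b; rewrite !mxE; field.
Qed.

Lemma curvature_levi_civita X Y Z x :
  smooth_mx U X -> smooth_mx U Y -> smooth_mx U Z -> U x ->
  curvature (levi_civita G) X Y Z x =
  \sum_i \sum_j (X x i 0 * Y x j 0) *: (curvmx Gam i j x *m Z x).
Proof.
apply: curvature_conn => [X' Y' y _ _|]; first exact: levi_civita_conn.
exact: smooth_christoffel.
Qed.

Lemma curvature_canonical X Y Z x :
  smooth_mx U X -> smooth_mx U Y -> smooth_mx U Z -> U x ->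
  curvature (canonical_connection G I) X Y Z x =
  \sum_i \sum_j (X x i 0 * Y x j 0) *: (curvmx (canonical_mx G I) i j x *m Z x).
Proof.
apply: curvature_conn; first exact: canonical_connection_conn.
exact: smooth_canonical_mx.
Qed.

Lemma curvmx_skew C i j x : curvmx C j i x = - curvmx C i j x.
Proof.
rewrite /curvmx opprK.
move: (C i x *m C j x) (C j x *m C i x) (pd i _ x) (pd j _ x) => a1 a2 a3 a4.
by apply/matrixP => a b; rewrite !mxE; ring.
Qed.

Lemma christoffel_sym k i j x : U x -> christoffel G x k i j = christoffel G x k j i.
Proof.
move=> Ux; rewrite /christoffel; congr (_ * _); apply: eq_bigr => l _.
congr (_ * (_ - _)); first by rewrite addrC.
by apply: (eq_partial oU) => // y Uy; rewrite -{1}symG // mxE.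
Qed.

Lemma curvmx_bianchi i j l k x : U x ->
  curvmx Gam i j x k l + curvmx Gam j l x k i + curvmx Gam l i x k j = 0.
Proof.
move=> Ux.
have [d [p [dsym psym E]]] : exists d p : 'I_4 -> 'I_4 -> 'I_4 -> R,
    [/\ forall a b c, d a b c = d a c b, forall a b c, p a b c = p a c b &
     forall a b c, curvmx Gam a b x k c =
       - (d a b c - d b a c + (p a b c - p b a c))].
  exists (fun a b c => partial a (fun y => Gam b y k c) x).
  exists (fun a b c => (Gam a x *m Gam b x) k c); split=> a b c.
  - by apply: (eq_partial oU) => // y Uy; rewrite !mxE christoffel_sym.
  - rewrite !mxE; apply: eq_bigr => e _; congr (_ * _).
    by rewrite !mxE christoffel_sym.
  rewrite /curvmx; move: (Gam a x *m Gam b x) (Gam b x *m Gam a x) => A B.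
  by rewrite !mxE.
apply: etrans (congr2 +%R (congr2 +%R (E i j l) (E j l i)) (E l i j)) _.
rewrite (dsym i j l) (dsym j i l) (dsym l j i).
rewrite (psym i j l) (psym j i l) (psym l j i).
by ring.
Qed.

Lemma metric_compatible i x : U x ->
  pd i G x = G x *m Gam i x + (G x *m Gam i x)^T.
Proof.
move=> Ux.
have [d [dE dsym]] : exists d : 'I_4 -> 'I_4 -> 'I_4 -> R,
    (forall a b c, partial a (fun y => G y b c) x = d a b c) /\
    (forall a b c, d a b c = d a c b).
  exists (fun a b c => partial a (fun y => G y b c) x); split=> // a b c.
  by apply: (eq_partial oU) => // y Uy; rewrite -{1}symG // mxE.
have E l j : (G x *m Gam i x) l j = 2^-1 * (d i j l + d j i l - d l i j).
  rewrite mxE; pose w := \col_l (d i j l + d j i l - d l i j).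
  have -> : \sum_k G x l k * Gam i x k j = (2^-1 *: (G x *m (invmx (G x) *m w))) l 0.
    rewrite !mxE mulr_sumr; apply: eq_bigr => k _; rewrite !mxE /christoffel mulrCA.
    by congr (_ * (_ * _)); apply: eq_bigr => m _; rewrite !mxE !dE.
  by rewrite mulmxA mulmxV ?uG // mul1mx !mxE.
apply/matrixP => a b; rewrite [LHS]mxE dE [RHS]mxE [X in _ = _ + X]mxE !E.
by rewrite (dsym i a b) (dsym a i b) (dsym b i a); field.
Qed.

Lemma curvmx_metric_skew i j x : U x ->
  (G x *m curvmx Gam i j x)^T = - (G x *m curvmx Gam i j x).
Proof.
move=> Ux; have sC := smooth_christoffel.
have dd a b : pd a (pd b G) x =
  pd a G x *m Gam b x + G x *m pd a (Gam b) x
  + (pd a G x *m Gam b x + G x *m pd a (Gam b) x)^T.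
  rewrite (eq_pd oU (G := fun y => G y *m Gam b y + (G y *m Gam b y)^T) a Ux); last first.
    by move=> y Uy; exact: metric_compatible.
  have sGC := smooth_mxM oU sG (sC b).
  have sT : smooth_mx U (fun y => (G y *m Gam b y)^T).
    by move=> c d; apply: (eq_smooth oU) (sGC d c) => y _; rewrite [RHS]mxE.
  by rewrite (pdD oU a sGC sT Ux) pd_tr (pdM oU a sG (sC b) Ux).
apply: (curvature_skew_alg (symG Ux) (metric_compatible i Ux) (metric_compatible j Ux)).
exact: etrans (esym (dd i j)) (etrans (pdC oU i j sG Ux) (dd j i)).
Qed.

Lemma pd_acs_anti i x : U x -> pd i I x *m I x = - (I x *m pd i I x).
Proof.
move=> Ux; apply/eqP; rewrite -subr_eq0 opprK -(pdM oU i sI sI Ux).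
rewrite (eq_pd oU i Ux (G := fun=> - 1%:M)) ?pd_cst //.
Qed.

Lemma nabla_acs_anti i x : U x ->
  nabla_acs G I i x *m I x = - (I x *m nabla_acs G I i x).
Proof.
move=> Ux; rewrite /nabla_acs !mulmxDr !mulmxDl mulNmx mulmxN pd_acs_anti //.
have -> : Gam i x *m I x *m I x = - Gam i x by rewrite -mulmxA sqI // mulmxN mulmx1.
rewrite !mulmxA sqI // !mulNmx mul1mx.
move: (I x *m pd i I x) (I x *m Gam i x *m I x) => a1 a2.
by apply/matrixP => k l; rewrite !linmxE; ring.
Qed.

Lemma metric_acs_skew x : U x -> (G x *m I x)^T = - (G x *m I x).
Proof.
move=> Ux; rewrite trmx_mul symG // -[in RHS](isoI Ux).
by rewrite -!mulmxA sqI // !mulmxN mulmx1 opprK.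
Qed.

Lemma nabla_acs_skew i x : U x ->
  (G x *m nabla_acs G I i x)^T = - (G x *m nabla_acs G I i x).
Proof.
move=> Ux; have sGI := smooth_mxM oU sG sI.
have dB : (pd i (fun y => G y *m I y) x)^T = - pd i (fun y => G y *m I y) x.
  rewrite -pd_tr -(pdN oU i sGI Ux); apply: (eq_pd oU) => // y Uy.
  exact: metric_acs_skew.
have E : G x *m nabla_acs G I i x = pd i (fun y => G y *m I y) x
    - ((Gam i x)^T *m (G x *m I x) + G x *m I x *m Gam i x).
  rewrite (pdM oU i sG sI Ux) metric_compatible // /nabla_acs !mulmxDr !mulmxDl mulmxN.
  rewrite trmx_mul symG // !mulmxA.
  move: (G x *m pd i I x) (G x *m Gam i x *m I x) (G x *m I x *m Gam i x) => a1 a2 a3.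
  move: ((Gam i x)^T *m G x *m I x) => a4.
  by apply/matrixP => k l; rewrite !linmxE; ring.
rewrite E linearB /= dB linearD /= !trmx_mul trmxK.
rewrite -[(I x)^T *m (G x)^T]trmx_mul metric_acs_skew //.
rewrite mulNmx mulmxN.
move: (pd i _ x) (G x *m I x *m Gam i x) ((Gam i x)^T *m (G x *m I x)) => a1 a2 a3.
by apply/matrixP => k l; rewrite !linmxE; ring.
Qed.

Lemma curvmx_canonical i j x : U x ->
  curvmx (canonical_mx G I) i j x =
  2^-1 *: (curvmx Gam i j x - I x *m curvmx Gam i j x *m I x)
  + 4^-1 *: (nabla_acs G I i x *m nabla_acs G I j x
             - nabla_acs G I j x *m nabla_acs G I i x).
Proof.
move=> Ux; have sC := smooth_christoffel.
have dC k l : pd k (canonical_mx G I l) x =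
    2^-1 *: (pd k (Gam l) x
             - (pd k I x *m pd l I x + I x *m pd k (pd l I) x)
             - ((pd k I x *m Gam l x + I x *m pd k (Gam l) x) *m I x
                + I x *m Gam l x *m pd k I x)).
  have sdI := smooth_pd oU l sI.
  have s1 := smooth_mxM oU sI sdI.
  have s2 := smooth_mxM oU sI (sC l).
  have s3 := smooth_mxM oU s2 sI.
  have s4 := smooth_mxD oU (sC l) (smooth_mxN oU s1).
  rewrite (pdZc oU _ k (smooth_mxD oU s4 (smooth_mxN oU s3)) Ux).
  rewrite (pdD oU k s4 (smooth_mxN oU s3) Ux) (pdD oU k (sC l) (smooth_mxN oU s1) Ux).
  rewrite (pdN oU k s1 Ux) (pdN oU k s3 Ux) (pdM oU k s2 sI Ux).
  by rewrite (pdM oU k sI sdI Ux) (pdM oU k sI (sC l) Ux).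
have := canonical_curvature_alg (sqI Ux) (pd_acs_anti i Ux) (pd_acs_anti j Ux)
  (Gam i x) (Gam j x) (pd i (pd j I) x) (pd i (Gam j) x) (pd j (Gam i) x).
move=> E; apply: etrans E; rewrite [in LHS]/curvmx (dC i j) (dC j i).
by rewrite (pdC oU j i sI Ux).
Qed.

End Connections.

(** * The Hodge star and algebraic curvature tensors on R^4 *)

Definition o0 : 'I_4 := @Ordinal 4 0 isT.
Definition o1 : 'I_4 := @Ordinal 4 1 isT.
Definition o2 : 'I_4 := @Ordinal 4 2 isT.
Definition o3 : 'I_4 := @Ordinal 4 3 isT.

Lemma ord4_ind (P : 'I_4 -> Prop) : P o0 -> P o1 -> P o2 -> P o3 -> forall i, P i.
Proof.
move=> P0 P1 P2 P3; case=> [[|[|[|[|//]]]] h].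
- by rewrite (_ : Ordinal h = o0) //; apply: val_inj.
- by rewrite (_ : Ordinal h = o1) //; apply: val_inj.
- by rewrite (_ : Ordinal h = o2) //; apply: val_inj.
- by rewrite (_ : Ordinal h = o3) //; apply: val_inj.
Qed.

Lemma sum4 (V : zmodType) (F : 'I_4 -> V) :
  \sum_i F i = F o0 + F o1 + F o2 + F o3.
Proof.
rewrite !big_ord_recl big_ord0 addr0 !addrA.
by congr (_ + _ + _ + _); congr F; apply: val_inj.
Qed.

Lemma prod4 (R : comNzRingType) (F : 'I_4 -> R) :
  \prod_i F i = F o0 * F o1 * F o2 * F o3.
Proof.
rewrite !big_ord_recl big_ord0 mulr1 !mulrA.
by congr (_ * _ * _ * _); congr F; apply: val_inj.
Qed.

Section LeviCivitaSymbol.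
Variable R : realType.

Definition eps (a b c d : 'I_4) : R :=
  \det (\matrix_(i < 4, j < 4) (tnth [tuple a; b; c; d] i == j)%:R : 'M[R]_4).

Lemma det_Vandermonde4 (u : 'I_4 -> R) :
  \det (\matrix_(i < 4, j < 4) u i ^+ j) =
  (u o1 - u o0) * (u o2 - u o0) * (u o3 - u o0)
  * (u o2 - u o1) * (u o3 - u o1) * (u o3 - u o2).
Proof.
rewrite -det_tr.
have -> : (\matrix_(i < 4, j < 4) u i ^+ j)^T = Vandermonde 4 (\row_i u i).
  by apply/matrixP => i j; rewrite !mxE.
rewrite det_Vandermonde; under eq_bigr => i _ do rewrite big_mkcond prod4 !mxE.
by rewrite prod4 /=; ring.
Qed.

(* Multiplying the defining matrix of [eps a b c d] by the Vandermonde matrix of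
   0, 1, 2, 3, of determinant 12, gives the Vandermonde matrix of a, b, c, d. *)
Lemma epsE (a b c d : 'I_4) : eps a b c d =
  (b%:R - a%:R) * (c%:R - a%:R) * (d%:R - a%:R)
  * (c%:R - b%:R) * (d%:R - b%:R) * (d%:R - c%:R) / 12.
Proof.
pose W : 'M[R]_4 := \matrix_(i < 4, j < 4) (i : nat)%:R ^+ j.
have dW : \det W = 12.
  rewrite /W (det_Vandermonde4 (fun i : 'I_4 => (i : nat)%:R)) /=; ring.
pose t := [tuple a; b; c; d].
have dE : eps a b c d * 12 = \det (\matrix_(i < 4, j < 4) (tnth t i : nat)%:R ^+ j : 'M[R]_4).
  rewrite -dW /eps -det_mulmx; congr (\det _); apply/matrixP => i j; rewrite !mxE.
  rewrite (bigD1 (tnth t i)) //= big1 => [|k kt]; rewrite !mxE.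
    by rewrite -/t [tnth t i == _]eqxx mul1r addr0.
  by rewrite eq_sym (negbTE kt) mul0r.
rewrite -[LHS](mulfK (_ : 12 != 0)) ?pnatr_eq0 // dE.
by rewrite (det_Vandermonde4 (fun i => (tnth t i : nat)%:R)).
Qed.

Definition star (A : 'M[R]_4) : 'M[R]_4 :=
  \matrix_(c, d) (2^-1 * \sum_a \sum_b A a b * eps a b c d).

Lemma starE (A : 'M[R]_4) c d : A^T = - A -> star A c d =
  A o0 o1 * eps o0 o1 c d + A o0 o2 * eps o0 o2 c d + A o0 o3 * eps o0 o3 c d
  + A o1 o2 * eps o1 o2 c d + A o1 o3 * eps o1 o3 c d + A o2 o3 * eps o2 o3 c d.
Proof.
move=> /matrixP skA.
have sk i j : A i j = - A j i by have := skA j i; rewrite !mxE.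
rewrite mxE !sum4 (sk o1 o0) (sk o2 o0) (sk o3 o0) (sk o2 o1) (sk o3 o1) (sk o3 o2).
rewrite !epsE /=.
by field.
Qed.

Definition selfdual (A : 'M[R]_4) : Prop :=
  [/\ A o0 o1 = A o2 o3, A o0 o2 = - A o1 o3 & A o0 o3 = A o1 o2].

Lemma star_selfdual (A : 'M[R]_4) : A^T = - A -> (star A = A <-> selfdual A).
Proof.
move=> skA; split.
  move/matrixP => sA; split; [have := sA o0 o1|have := sA o0 o2|have := sA o0 o3];
  by rewrite (starE _ _ skA) !epsE /= => <-; field.
case=> h1 h2 h3.
have sk i j : A i j = - A j i by move/matrixP: (skA) => /(_ j i); rewrite !mxE.
have d0 i : A i i = 0 by have := sk i i; move: (A i i) => z; lra.
apply/matrixP; do 2 (apply: ord4_ind); rewrite (starE _ _ skA) h1 h2 h3 !epsE /=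
  ?d0 ?(sk o1 o0) ?(sk o2 o0) ?(sk o3 o0) ?(sk o2 o1) ?(sk o3 o1) ?(sk o3 o2)
  ?h1 ?h2 ?h3; by field.
Qed.

Definition stdI : 'M[R]_4 := \matrix_(i < 4, j < 4)
  nth 0 (nth [::] [:: [:: 0; -1; 0; 0]; [:: 1; 0; 0; 0];
                      [:: 0; 0; 0; -1]; [:: 0; 0; 1; 0]] i) j.

Lemma star_stdI : star stdI^T o0 o1 = 1.
Proof.
rewrite starE; last first.
  by apply/matrixP; do 2 (apply: ord4_ind); rewrite !mxE /= ?oppr0 ?opprK.
by rewrite !mxE !epsE /=; field.
Qed.

Lemma skew_anti_stdI (J : 'M[R]_4) : J^T = - J -> J *m stdI = - (stdI *m J) ->
  [/\ J o0 o1 = 0, J o2 o3 = 0, J o0 o2 = - J o1 o3 & J o0 o3 = J o1 o2].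
Proof.
move=> /matrixP skJ /matrixP anJ.
have sk i j : J i j = - J j i by have := skJ j i; rewrite !mxE.
have := anJ o0 o0; have := anJ o2 o2; have := anJ o0 o3; have := anJ o0 o2.
rewrite !mxE !sum4 !mxE /= (sk o1 o0) (sk o3 o2).
move: (J o0 o1) (J o2 o3) (J o0 o2) (J o1 o3) (J o0 o3) (J o1 o2) => a b c d e f.
by move=> E1 E2 E3 E4; split; lra.
Qed.

Lemma scale_stdIE (K : 'M[R]_4) :
  K = (4^-1 * \sum_a \sum_b K a b * stdI a b) *: stdI <-> exists k, K = k *: stdI.
Proof.
split=> [->|[k ->]]; first by eexists.
congr (_ *: _); by rewrite !sum4 !mxE /=; field.
Qed.

Lemma selfdual_canonical (E J1 J2 : 'M[R]_4) :
  E^T = - E -> J1^T = - J1 -> J2^T = - J2 ->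
  J1 *m stdI = - (stdI *m J1) -> J2 *m stdI = - (stdI *m J2) ->
  let K := 2^-1 *: (E - stdI *m E *m stdI) + 4^-1 *: (J1 *m J2 - J2 *m J1) in
  K = (4^-1 * \sum_a \sum_b K a b * stdI a b) *: stdI <-> selfdual E.
Proof.
move=> skE sk1 sk2 an1 an2 K; rewrite scale_stdIE.
have [p1 p2 p3 p4] := skew_anti_stdI sk1 an1.
have [q1 q2 q3 q4] := skew_anti_stdI sk2 an2.
have sk (A : 'M[R]_4) : A^T = - A -> forall i j, A i j = - A j i.
  by move=> /matrixP skA i j; have := skA j i; rewrite !mxE.
have d0 (A : 'M[R]_4) : A^T = - A -> forall i, A i i = 0.
  by move=> /sk skA i; have := skA i i; move: (A i i) => z; lra.
have {}sk1 := (d0 _ sk1, (sk _ sk1 o1 o0, sk _ sk1 o2 o0, sk _ sk1 o3 o0,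
  sk _ sk1 o2 o1, sk _ sk1 o3 o1, sk _ sk1 o3 o2)).
have {}sk2 := (d0 _ sk2, (sk _ sk2 o1 o0, sk _ sk2 o2 o0, sk _ sk2 o3 o0,
  sk _ sk2 o2 o1, sk _ sk2 o3 o1, sk _ sk2 o3 o2)).
have {}skE := (d0 _ skE, (sk _ skE o1 o0, sk _ skE o2 o0, sk _ skE o3 o0,
  sk _ skE o2 o1, sk _ skE o3 o1, sk _ skE o3 o2)).
have IEI c d : (stdI *m E *m stdI) c d =
    \sum_k (\sum_l stdI c l * E l k) * stdI k d.
  by rewrite mxE; apply: eq_bigr => k _; rewrite mxE.
have KE c d : K c d = 2^-1 * (E c d - (stdI *m E *m stdI) c d)
   + 4^-1 * (\sum_k J1 c k * J2 k d - \sum_k J2 c k * J1 k d).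
  by rewrite /K !linmxE; congr (_ + _ * (_ - _)); rewrite mxE.
split=> [[k /matrixP EK]|[h1 h2 h3]].
  have := EK o0 o1; have := EK o2 o3; have := EK o0 o2; have := EK o0 o3.
  rewrite !KE !IEI !sum4 !mxE /= !(sk1, sk2, skE, p1, p2, p3, p4, q1, q2, q3, q4).
  by move=> E1 E2 E3 E4; split; lra.
exists (- (E o2 o3 + 2^-1 * (J1 o1 o3 * J2 o1 o2 - J1 o1 o2 * J2 o1 o3))).
apply/matrixP; do 2 (apply: ord4_ind); rewrite KE IEI !sum4 !mxE /=.
all: rewrite !(sk1, sk2, skE, p1, p2, p3, p4, q1, q2, q3, q4, h1, h2, h3).
all: by field.
Qed.

Section AlgebraicCurvature.
Variable T : 'I_4 -> 'I_4 -> 'M[R]_4.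
Hypothesis skT : forall a b, T b a = - T a b.
Hypothesis skT' : forall a b, (T a b)^T = - T a b.
Hypothesis bianchi : forall a b c d, T a b c d + T b c a d + T c a b d = 0.

Let sk1 a b c d : T b a c d = - T a b c d.
Proof. by rewrite (skT a b) mxE. Qed.

Let sk2 a b c d : T a b d c = - T a b c d.
Proof. by have /matrixP/(_ c d) := skT' a b; rewrite !mxE. Qed.

Let d1 a c d : T a a c d = 0.
Proof. by have := sk1 a a c d; move: (T a a c d) => z; lra. Qed.

Let d2 a b c : T a b c c = 0.
Proof. by have := sk2 a b c c; move: (T a b c c) => z; lra. Qed.

Lemma pair_sym a b c d : T c d a b = T a b c d.
Proof.
have := bianchi a b c d; have := bianchi b c d a.
have := bianchi c d a b; have := bianchi d a b c.
have := sk2 b c a d; have := sk2 c d a b; have := sk1 b d c a; have := sk2 b d a c.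
have := sk2 d a b c; have := sk1 c a d b; have := sk2 c a b d; have := sk2 a b c d.
move: (T a b c d) (T b c a d) (T c a b d) (T b c d a) (T c d b a) (T d b c a).
move: (T c d a b) (T d a c b) (T a c d b) (T d a b c) (T a b d c) (T b d a c).
move: (T b d c a) (T c a d b) => x1 x2 x3 x4 x5 x6 x7 x8 x9 x10 x11 x12 x13 x14.
by move=> *; lra.
Qed.

Let normT := (d1, d2, (sk1 o0 o1, sk1 o0 o2, sk1 o0 o3, sk1 o1 o2, sk1 o1 o3, sk1 o2 o3),
  (fun a b => sk2 a b o0 o1, fun a b => sk2 a b o0 o2, fun a b => sk2 a b o0 o3,
   fun a b => sk2 a b o1 o2, fun a b => sk2 a b o1 o3, fun a b => sk2 a b o2 o3),
  (pair_sym o0 o1 o0 o2, pair_sym o0 o1 o0 o3, pair_sym o0 o1 o1 o2,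
  pair_sym o0 o1 o1 o3, pair_sym o0 o1 o2 o3, pair_sym o0 o2 o0 o3,
  pair_sym o0 o2 o1 o2, pair_sym o0 o2 o1 o3, pair_sym o0 o2 o2 o3,
  pair_sym o0 o3 o1 o2, pair_sym o0 o3 o1 o3, pair_sym o0 o3 o2 o3,
  pair_sym o1 o2 o1 o3, pair_sym o1 o2 o2 o3, pair_sym o1 o3 o2 o3)).

Lemma selfdual_ricci_flat : (forall a b, selfdual (T a b)) ->
  forall a b, \sum_k T a k b k = 0.
Proof.
move=> sdT.
have [a1 a2 a3] := sdT o0 o1; have [b1 b2 b3] := sdT o0 o2.
have [c1 c2 c3] := sdT o0 o3; have [e1 e2 e3] := sdT o1 o2.
have [f1 f2 f3] := sdT o1 o3; have [g1 g2 g3] := sdT o2 o3.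
have B := bianchi o0 o1 o2 o3.
move: a1 a2 a3 b1 b2 b3 c1 c2 c3 e1 e2 e3 f1 f2 f3 g1 g2 g3 B.
rewrite !normT => a1 a2 a3 b1 b2 b3 c1 c2 c3 e1 e2 e3 f1 f2 f3 g1 g2 g3 B.
by do 2 (apply: ord4_ind); rewrite !sum4 !normT; lra.
Qed.

Lemma ricci_flat_selfdual : (forall a b, \sum_k T a k b k = 0) ->
  selfdual (T o0 o1 - T o2 o3) -> selfdual (T o0 o2 + T o1 o3) ->
  selfdual (T o0 o3 - T o1 o2) -> forall a b, selfdual (T a b).
Proof.
move=> ricT sd1 sd2 sd3.
have B := bianchi o0 o1 o2 o3.
have r00 := ricT o0 o0; have r01 := ricT o0 o1; have r02 := ricT o0 o2.
have r03 := ricT o0 o3; have r11 := ricT o1 o1; have r12 := ricT o1 o2.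
have r13 := ricT o1 o3; have r22 := ricT o2 o2; have r23 := ricT o2 o3.
have r33 := ricT o3 o3.
move: B r00 r01 r02 r03 r11 r12 r13 r22 r23 r33 sd1 sd2 sd3.
rewrite /selfdual !sum4 !linmxE !normT => B r00 r01 r02 r03 r11 r12 r13 r22 r23 r33.
move=> [a1 a2 a3] [b1 b2 b3] [c1 c2 c3].
by do 2 (apply: ord4_ind); rewrite ?normT; split; lra.
Qed.

End AlgebraicCurvature.

End LeviCivitaSymbol.

(** * Adapted orthonormal frames *)

Section AdaptedFrame.
Variables (R : realType) (g I : 'M[R]_4).
Hypothesis gT : g^T = g.
Hypothesis gpos : forall u : 'cV[R]_4, u != 0 -> 0 < (u^T *m g *m u) 0 0.
Hypothesis sqI : I *m I = - 1%:M.
Hypothesis isoI : I^T *m g *m I = g.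
Implicit Types u v : 'cV[R]_4.

Let ip u v : R := (u^T *m g *m v) 0 0.

Let ipC u v : ip u v = ip v u.
Proof. by rewrite /ip -[in LHS](trmxK (u^T *m g *m v)) mxE !trmx_mul trmxK gT mulmxA. Qed.

Let ipN u v : ip u (- v) = - ip u v.
Proof. by rewrite /ip mulmxN mxE. Qed.

Let ipII u v : ip (I *m u) (I *m v) = ip u v.
Proof. by rewrite /ip trmx_mul -!mulmxA [I^T *m _]mulmxA [I^T *m g *m _]mulmxA isoI. Qed.

Let IIu u : I *m (I *m u) = - u.
Proof. by rewrite mulmxA sqI mulNmx mul1mx. Qed.

Let ipI u v : ip (I *m u) v = - ip u (I *m v).
Proof. by rewrite -(ipII u) IIu ipN opprK. Qed.

Let ipIu u : ip u (I *m u) = 0.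
Proof. by have := ipI u u; rewrite ipC; move: (ip u _) => z; lra. Qed.

Let normalize u : u != 0 -> exists k, ip (k *: u) (k *: u) = 1.
Proof.
move=> /gpos u0; exists (Num.sqrt (ip u u))^-1.
have -> k : ip (k *: u) (k *: u) = k * (k * ip u u).
  by rewrite /ip !linearZ /= -!scalemxAl !mxE.
rewrite mulrA -expr2 exprVn sqr_sqrtr ?ltW // mulVf //.
by rewrite gt_eqF.
Qed.

Lemma adapted_frame : exists P : 'M[R]_4,
  P^T *m g *m P = 1%:M /\ I *m P = P *m stdI R.
Proof.
have [k uu] : exists k, ip (k *: evec R o0) (k *: evec R o0) = 1.
  apply: normalize; apply/eqP => /matrixP/(_ o0 0); rewrite !mxE !eqxx.
  by move/eqP; rewrite oner_eq0.
move: (k *: _) uu => u uu {k}.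
pose B : 'M[R]_(4, 1 + 1) := row_mx (g *m u) (g *m (I *m u)).
have [w w0 wB] : exists2 w : 'rV[R]_4, w != 0 & w *m B = 0.
  have : kermx B != 0.
    rewrite -mxrank_eq0 mxrank_ker subn_eq0 -ltnNge.
    exact: leq_ltn_trans (rank_leq_col _) _.
  case/rowV0Pn => w /sub_kermxP wB w0; by exists w.
move: wB; rewrite mul_mx_row -row_mx0 => /eq_row_mx [wu wIu].
have [k vv] : exists k, ip (k *: w^T) (k *: w^T) = 1.
  by apply: normalize; rewrite trmx_eq0.
have vu : ip (k *: w^T) u = 0.
  by rewrite /ip linearZ /= trmxK -!scalemxAl -mulmxA wu scaler0 mxE.
have vIu : ip (k *: w^T) (I *m u) = 0.
  by rewrite /ip linearZ /= trmxK -!scalemxAl -mulmxA wIu scaler0 mxE.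
move: (k *: w^T) vv vu vIu => v vv vu vIu {k w w0 wu wIu B}.
pose f (j : 'I_4) : 'cV[R]_4 := nth 0 [:: u; I *m u; v; I *m v] j.
pose P : 'M[R]_4 := \matrix_(i, j) f j i 0.
have colP j : col j P = f j by apply/matrixP => i z; rewrite (ord1 z) !mxE.
exists P; split.
  have E i j : (P^T *m g *m P) i j = ip (f i) (f j).
    rewrite /ip -!colP tr_col -row_mul [LHS]mxE [RHS]mxE.
    by apply: eq_bigr => k _; rewrite [X in _ = X * _]mxE [X in _ = _ * X]mxE.
  apply/matrixP; do 2 (apply: ord4_ind); rewrite E mxE /f /=;
  rewrite ?ipII ?ipI ?IIu ?ipN ?ipIu ?uu ?vv ?vu ?vIu ?(ipC u v) ?(ipC u (I *m v))
    ?ipI ?vu ?vIu ?oppr0 ?opprK //.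
apply/matrixP => i; apply: ord4_ind.
all: have -> j : (I *m P) i j = (I *m f j) i 0
  by rewrite -colP !mxE; apply: eq_bigr => l _; rewrite !mxE.
all: rewrite /f /= ?IIu [RHS]mxE sum4 !mxE /=; ring.
Qed.

End AdaptedFrame.

Section FrameComponents.
Variables (R : realType) (P : 'M[R]_4).
Implicit Types (M : 'I_4 -> 'I_4 -> 'M[R]_4) (A B : 'M[R]_4).

(* The last two indices of the 4-tensor [M] are matrix indices. *)
Definition frame_comp M (i j : 'I_4) : 'M[R]_4 :=
  P^T *m (\sum_a \sum_b (P a i * P b j) *: M a b) *m P.

Lemma frame_compE M i j k l : frame_comp M i j k l =
  \sum_a \sum_b \sum_c \sum_d P a i * P b j * P c k * P d l * M a b c d.
Proof.
rewrite /frame_comp mulmx_sumr mulmx_suml summxE; apply: eq_bigr => a _.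
rewrite mulmx_sumr mulmx_suml summxE; apply: eq_bigr => b _.
rewrite -scalemxAr -scalemxAl !mxE mulr_sumr exchange_big /=.
apply: eq_bigr => d _; rewrite !mxE mulr_suml mulr_sumr.
by apply: eq_bigr => c _; rewrite !mxE; ring.
Qed.

Lemma frame_comp_skew M : (forall a b, M b a = - M a b) ->
  forall i j, frame_comp M j i = - frame_comp M i j.
Proof.
move=> skM i j; rewrite /frame_comp -mulNmx -mulmxN; congr (_ *m _ *m _).
rewrite exchange_big /= -sumrN; apply: eq_bigr => a _.
rewrite -sumrN; apply: eq_bigr => b _.
by rewrite (skM a b) scalerN [P b j * _]mulrC.
Qed.

Lemma frame_comp_skew' M : (forall a b, (M a b)^T = - M a b) ->
  forall i j, (frame_comp M i j)^T = - frame_comp M i j.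
Proof.
move=> skM i j; rewrite /frame_comp !trmx_mul trmxK mulmxA -mulNmx -mulmxN.
congr (_ *m _ *m _); rewrite linear_sum /= -sumrN; apply: eq_bigr => a _.
rewrite linear_sum /= -sumrN; apply: eq_bigr => b _.
by rewrite linearZ /= skM scalerN.
Qed.

Lemma rotate_sum (F : 'I_4 -> 'I_4 -> 'I_4 -> R) :
  \sum_b \sum_c \sum_a F a b c = \sum_a \sum_b \sum_c F a b c.
Proof.
rewrite [RHS]exchange_big /=; apply: eq_bigr => b _; exact: exchange_big.
Qed.

Lemma frame_comp_bianchi M :
  (forall a b c d, M a b c d + M b c a d + M c a b d = 0) ->
  forall i j k l, frame_comp M i j k l + frame_comp M j k i l + frame_comp M k i j l = 0.
Proof.
move=> BM i j k l.
have -> : frame_comp M j k i l = \sum_a \sum_b \sum_c \sum_d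
    P b j * P c k * P a i * P d l * M b c a d.
  rewrite frame_compE.
  exact: (rotate_sum (fun a b c => \sum_d P b j * P c k * P a i * P d l * M b c a d)).
have -> : frame_comp M k i j l = \sum_a \sum_b \sum_c \sum_d
    P c k * P a i * P b j * P d l * M c a b d.
  rewrite frame_compE; apply: esym.
  exact: (rotate_sum (fun c a b => \sum_d P c k * P a i * P b j * P d l * M c a b d)).
rewrite frame_compE -!big_split /= big1 // => a _.
rewrite -!big_split /= big1 // => b _; rewrite -!big_split /= big1 // => c _.
rewrite -!big_split /= big1 // => d _.
rewrite -[RHS](mulr0 (P a i * P b j * P c k * P d l)) -(BM a b c d).
by ring.
Qed.

Lemma frame_comp_sum M B :
  P^T *m (\sum_a \sum_b (P *m B *m P^T) a b *: M a b) *m P =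
  \sum_i \sum_j B i j *: frame_comp M i j.
Proof.
under [RHS]eq_bigr => i _ do under eq_bigr => j _ do
  rewrite /frame_comp scalemxAl scalemxAr.
under [RHS]eq_bigr => i _ do rewrite -mulmx_suml -mulmx_sumr.
rewrite -mulmx_suml -mulmx_sumr; congr (_ *m _ *m _).
rewrite !pair_bigA /=.
under [RHS]eq_bigr => p _ do rewrite pair_bigA /= scaler_sumr.
rewrite exchange_big /=; apply: eq_bigr => q _.
under eq_bigr => p _ do rewrite scalerA.
rewrite -scaler_suml; congr (_ *: _).
rewrite -(pair_bigA _ (fun i j => B i j * (P q.1 i * P q.2 j))) /= mxE exchange_big /=.
apply: eq_bigr => j _; rewrite !mxE mulr_suml; apply: eq_bigr => i _.
by ring.
Qed.

Lemma frame_comp_inv M (Q : 'M[R]_4) a b : P *m Q = 1%:M ->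
  P^T *m M a b *m P = \sum_i \sum_j (Q i a * Q j b) *: frame_comp M i j.
Proof.
move=> PQ; have := frame_comp_sum M (Q *m delta_mx a b *m Q^T).
have -> : P *m (Q *m delta_mx a b *m Q^T) *m P^T = delta_mx a b.
  by rewrite !mulmxA PQ mul1mx -mulmxA -trmx_mul PQ trmx1 mulmx1.
rewrite (bigD1 a) //= [X in _ + X]big1 ?addr0 => [|c ca]; last first.
  by rewrite big1 // => d _; rewrite mxE (negbTE ca) scale0r.
rewrite (bigD1 b) //= [X in _ + X]big1 ?addr0 => [|d db]; last first.
  by rewrite mxE (negbTE db) andbF scale0r.
rewrite mxE !eqxx scale1r => ->; apply: eq_bigr => i _; apply: eq_bigr => j _.
congr (_ *: _); rewrite mxE (bigD1 b) //= big1 ?addr0 => [|d db].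
  rewrite !mxE (bigD1 a) //= big1 ?addr0 => [|c ca]; rewrite mxE ?eqxx ?mulr1 //.
  by rewrite (negbTE ca) mulr0.
by rewrite !mxE big1 ?mul0r // => c _; rewrite mxE (negbTE db) andbF mulr0.
Qed.

Lemma sum4_prod (f1 f2 f3 f4 : 'I_4 -> R) :
  \sum_a \sum_b \sum_c \sum_d f1 a * f2 b * f3 c * f4 d =
  (\sum_a f1 a) * (\sum_b f2 b) * (\sum_c f3 c) * (\sum_d f4 d).
Proof.
rewrite !mulr_suml; apply: eq_bigr => a _.
rewrite [f1 a * _]mulr_sumr !mulr_suml; apply: eq_bigr => b _.
rewrite [f1 a * f2 b * _]mulr_sumr mulr_suml; apply: eq_bigr => c _.
by rewrite mulr_sumr.
Qed.

Lemma sum_delta (f : 'I_4 -> R) k : \sum_a f a * (a == k)%:R = f k.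
Proof.
rewrite (bigD1 k) //= eqxx mulr1 big1 ?addr0 // => a ak.
by rewrite (negbTE ak) mulr0.
Qed.

Lemma eps_perm a b c d : eps R a b c d = \sum_(s : {perm 'I_4})
  (-1) ^+ s * ((a == s o0)%:R * (b == s o1)%:R * (c == s o2)%:R * (d == s o3)%:R).
Proof. by apply: eq_bigr => s _; congr (_ * _); rewrite prod4 !mxE. Qed.

Lemma frame_comp_eps i j k l :
  frame_comp (fun a b => \matrix_(c, d) eps R a b c d) i j k l
  = \det P * eps R i j k l.
Proof.
rewrite frame_compE.
under eq_bigr => a _ do under eq_bigr => b _ do under eq_bigr => c _ do
  under eq_bigr => d _ do rewrite mxE eps_perm mulr_sumr.
under eq_bigr => a _ do under eq_bigr => b _ do under eq_bigr => c _ do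
  rewrite exchange_big.
under eq_bigr => a _ do under eq_bigr => b _ do rewrite exchange_big.
under eq_bigr => a _ do rewrite exchange_big.
rewrite exchange_big /= /eps -det_tr mulrC -det_mulmx.
apply: eq_bigr => s _.
rewrite prod4.
have E m : ((\matrix_(m0, n0) (tnth [tuple i; j; k; l] m0 == n0)%:R : 'M[R]_4) *m P^T)
   m (s m) = P (s m) (tnth [tuple i; j; k; l] m).
  rewrite !mxE -[RHS](sum_delta (P (s m))); apply: eq_bigr => n _.
  by rewrite !mxE mulrC eq_sym.
rewrite !E /=.
rewrite -(sum_delta (P^~ i)) -(sum_delta (P^~ j)) -(sum_delta (P^~ k)) -(sum_delta (P^~ l)).
rewrite -sum4_prod mulr_sumr; apply: eq_bigr => a _; rewrite mulr_sumr.
apply: eq_bigr => b _; rewrite mulr_sumr; apply: eq_bigr => c _; rewrite mulr_sumr.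
apply: eq_bigr => d _;
move: ((-1) ^+ _) (a == _)%:R (b == _)%:R (c == _)%:R (d == _)%:R => x0 x1 x2 x3 x4.
by ring.
Qed.

End FrameComponents.

Section SelfdualForms.
Variable R : realType.
Implicit Types A B : 'M[R]_4.

Lemma selfdual0 : selfdual (0 : 'M[R]_4).
Proof. by split; rewrite !mxE ?oppr0. Qed.

Lemma selfdualD A B : selfdual A -> selfdual B -> selfdual (A + B).
Proof.
by move=> [a1 a2 a3] [b1 b2 b3]; split; rewrite !mxE ?a1 ?a2 ?a3 ?b1 ?b2 ?b3 ?opprD.
Qed.

Lemma selfdualZ k A : selfdual A -> selfdual (k *: A).
Proof. by move=> [a1 a2 a3]; split; rewrite !mxE ?a1 ?a2 ?a3 ?mulrN. Qed.

Lemma selfdual_sum (F : 'I_4 -> 'M[R]_4) :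
  (forall i, selfdual (F i)) -> selfdual (\sum_i F i).
Proof.
by move=> sF; apply: (big_ind (@selfdual R)) => //; [exact: selfdual0|exact: selfdualD].
Qed.

Lemma selfdual_scaleP k A : k != 0 -> selfdual (k *: A) -> selfdual A.
Proof. by move=> k0 /(selfdualZ k^-1); rewrite scalerA mulVf // scale1r. Qed.

Definition wedge (a b : 'I_4) : 'M[R]_4 := delta_mx a b - delta_mx b a.

Lemma wedge_skew a b : (wedge a b)^T = - wedge a b.
Proof. by rewrite /wedge linearB /= !trmx_delta opprB. Qed.

Lemma star_wedge01 : star (wedge o0 o1) = wedge o2 o3.
Proof.
by apply/matrixP; do 2 (apply: ord4_ind);
  rewrite (starE _ _ (wedge_skew _ _)) !epsE !mxE /=; field.
Qed.

Lemma star_wedge02 : star (wedge o0 o2) = - wedge o1 o3.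
Proof.
by apply/matrixP; do 2 (apply: ord4_ind);
  rewrite (starE _ _ (wedge_skew _ _)) !epsE !mxE /=; field.
Qed.

Lemma star_wedge03 : star (wedge o0 o3) = wedge o1 o2.
Proof.
by apply/matrixP; do 2 (apply: ord4_ind);
  rewrite (starE _ _ (wedge_skew _ _)) !epsE !mxE /=; field.
Qed.

Lemma sum_wedge (M : 'I_4 -> 'I_4 -> 'M[R]_4) a b : (forall c d, M d c = - M c d) ->
  \sum_c \sum_d wedge a b c d *: M c d = 2 *: M a b.
Proof.
move=> skM.
have D i j : \sum_c \sum_d (delta_mx i j : 'M[R]_4) c d *: M c d = M i j.
  rewrite (bigD1 i) //= [X in _ + X]big1 ?addr0 => [|c ci]; last first.
    by rewrite big1 // => d _; rewrite mxE (negbTE ci) scale0r.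
  rewrite (bigD1 j) //= [X in _ + X]big1 ?addr0 => [|d dj]; last first.
    by rewrite mxE (negbTE dj) andbF scale0r.
  by rewrite mxE !eqxx scale1r.
under eq_bigr => c _ do under eq_bigr => d _ do rewrite addmxE oppmxE scalerBl.
under eq_bigr => c _ do rewrite sumrB.
by rewrite sumrB !D (skM a b) opprK scaler_nat mulr2n.
Qed.

End SelfdualForms.

Section PointwiseFrame.
Variables (R : realType) (G I : 'cV[R]_4 -> 'M[R]_4) (x : 'cV[R]_4) (P : 'M[R]_4).
Hypothesis GT : (G x)^T = G x.
Hypothesis PGP : P^T *m G x *m P = 1%:M.
Hypothesis IP : I x *m P = P *m stdI R.
Implicit Types (A B E : 'M[R]_4).

Lemma frame_inv : P *m (P^T *m G x) = 1%:M.
Proof. exact: mulmx1C. Qed.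

Lemma metric_unit : G x \in unitmx.
Proof. by have := frame_inv; rewrite mulmxA => /mulmx1_unit []. Qed.

Lemma inv_metric : invmx (G x) = P *m P^T.
Proof.
by rewrite -[LHS]mul1mx -frame_inv mulmxA -!mulmxA mulmxV ?metric_unit // mulmx1.
Qed.

Lemma frame_inj A B : P^T *m A *m P = P^T *m B *m P -> A = B.
Proof.
have PQ := frame_inv; have QP : G x *m P *m P^T = 1%:M.
  by rewrite -mulmxA -inv_metric mulmxV ?metric_unit.
move=> /(congr1 (fun M => G x *m P *m M *m (P^T *m G x))).
rewrite !mulmxA QP !mul1mx -!mulmxA.
by rewrite [P *m _]mulmxA -[P *m P^T *m G x]mulmxA PQ !mulmx1.
Qed.

Lemma raiseE A : raise G x A = P *m (P^T *m A *m P) *m P^T.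
Proof.
have -> : P *m (P^T *m A *m P) *m P^T = invmx (G x) *m A *m (invmx (G x))^T.
  by rewrite inv_metric trmx_mul trmxK !mulmxA.
apply/matrixP => a b; rewrite !mxE exchange_big /=; apply: eq_bigr => d _.
by rewrite !mxE mulr_suml; apply: eq_bigr => c _; ring.
Qed.

Lemma inner2_frame A B : inner2 G x A B =
  2^-1 * \sum_a \sum_b (P^T *m A *m P) a b * (P^T *m B *m P) a b.
Proof.
have tr (M N : 'M[R]_4) : \sum_a \sum_b M a b * N a b = \tr (M *m N^T).
  by apply: eq_bigr => a _; rewrite mxE; apply: eq_bigr => b _; rewrite mxE.
rewrite /inner2 !tr raiseE; congr (_ * _).
by rewrite -!mulmxA mxtrace_mulC !trmx_mul trmxK !mulmxA.
Qed.

Lemma hodge_frame o A : P^T *m hodge G o x A *m P =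
  (o * Num.sqrt (\det (G x)) * \det P) *: star (P^T *m A *m P).
Proof.
set k := o * Num.sqrt _.
have -> : hodge G o x A = (2^-1 * k) *: \sum_a \sum_b
    (P *m (P^T *m A *m P) *m P^T) a b *: (\matrix_(c, d) eps R a b c d : 'M[R]_4).
  apply/matrixP => c d; rewrite -raiseE [LHS]mxE scalemxE -mulrA; congr (_ * _).
  rewrite summxE mulr_sumr; apply: eq_bigr => a _.
  rewrite summxE mulr_sumr; apply: eq_bigr => b _.
  by rewrite scalemxE mxE /volume -/k mulrCA.
rewrite -scalemxAr -scalemxAl frame_comp_sum.
move: (\det P) (frame_comp_eps P) => D eE.
apply/matrixP => c d; rewrite !scalemxE [star _ _ _]mxE summxE !mulr_sumr.
apply: eq_bigr => a _; rewrite summxE !mulr_sumr; apply: eq_bigr => b _.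
by rewrite scalemxE eE; ring.
Qed.

Lemma kahler_formE : kahler_form G I x = (I x)^T *m G x.
Proof.
apply/matrixP => a b; rewrite mxE /inner trmx_mul /evec trmx_delta.
by rewrite -colE -mulmxA -rowE [LHS]mxE [LHS]mxE.
Qed.

Lemma kahler_frame : P^T *m kahler_form G I x *m P = (stdI R)^T.
Proof.
rewrite kahler_formE mulmxA -trmx_mul IP trmx_mul -!mulmxA.
by rewrite [P^T *m _]mulmxA PGP mulmx1.
Qed.

Lemma kahler_multiple A :
  A = (2^-1 * inner2 G x A (kahler_form G I x)) *: kahler_form G I x
  <-> exists k, A = k *: kahler_form G I x.
Proof.
split=> [E|[k ->]]; first by eexists; exact: E.
congr (_ *: _); rewrite inner2_frame -scalemxAr -scalemxAl kahler_frame.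
by rewrite !sum4 !mxE /=; field.
Qed.

Definition frame_end A : 'M[R]_4 := P^T *m G x *m A *m P.

Lemma frame_endM A B : frame_end (A *m B) = frame_end A *m frame_end B.
Proof.
rewrite /frame_end -!mulmxA; do 3 congr (_ *m _).
by rewrite !mulmxA -[P *m P^T *m G x]mulmxA frame_inv mul1mx.
Qed.

Lemma frame_endD A B : frame_end (A + B) = frame_end A + frame_end B.
Proof. by rewrite /frame_end mulmxDr mulmxDl. Qed.

Lemma frame_endZ k A : frame_end (k *: A) = k *: frame_end A.
Proof. by rewrite /frame_end -scalemxAr -scalemxAl. Qed.

Lemma frame_endN A : frame_end (- A) = - frame_end A.
Proof. by rewrite -scaleN1r frame_endZ scaleN1r. Qed.

Lemma frame_end_acs : frame_end (I x) = stdI R.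
Proof. by rewrite /frame_end -mulmxA IP mulmxA PGP mul1mx. Qed.

Lemma frame_end_skew A : (G x *m A)^T = - (G x *m A) -> (frame_end A)^T = - frame_end A.
Proof.
move=> skA; rewrite /frame_end -[P^T *m G x *m A]mulmxA !trmx_mul trmxK.
by rewrite -trmx_mul skA mulNmx mulmxN mulmxA.
Qed.

Lemma frame_form A : P^T *m (A^T *m G x) *m P = (frame_end A)^T.
Proof. by rewrite /frame_end !trmx_mul trmxK GT !mulmxA. Qed.

Variable o : R.
Hypothesis hodge_kahler : hodge G o x (kahler_form G I x) = kahler_form G I x.

(* The sign of the frame is fixed by testing the Hodge star on the Kaehler form. *)
Lemma hodge_frame_oriented A : P^T *m hodge G o x A *m P = star (P^T *m A *m P).
Proof.
rewrite hodge_frame.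
have := hodge_frame o (kahler_form G I x); rewrite hodge_kahler kahler_frame.
move/matrixP/(_ o0 o1); rewrite scalemxE star_stdI mulr1 => <-.
by rewrite !mxE /= scale1r.
Qed.

Lemma frame_skew A : A^T = - A -> (P^T *m A *m P)^T = - (P^T *m A *m P).
Proof. by move=> skA; rewrite !trmx_mul trmxK skA mulNmx mulmxN mulmxA. Qed.

Lemma asd_part_frame A : P^T *m asd_part G o x A *m P =
  2^-1 *: (P^T *m A *m P - star (P^T *m A *m P)).
Proof.
rewrite /asd_part -scalemxAr -scalemxAl mulmxBr mulmxBl.
by rewrite hodge_frame_oriented.
Qed.

Lemma asd_part_eq0 A : A^T = - A ->
  asd_part G o x A = 0 <-> selfdual (P^T *m A *m P).
Proof.
move=> skA; rewrite -star_selfdual ?frame_skew //; split=> [A0|sA].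
  have := asd_part_frame A; rewrite A0 mulmx0 mul0mx => /esym/eqP.
  by rewrite scaler_eq0 invr_eq0 pnatr_eq0 /= subr_eq0 => /eqP.
by apply: frame_inj; rewrite asd_part_frame sA subrr scaler0 mulmx0 mul0mx.
Qed.

Lemma canonical_kahler_selfdual E J1 J2 :
  (G x *m E)^T = - (G x *m E) ->
  (G x *m J1)^T = - (G x *m J1) -> (G x *m J2)^T = - (G x *m J2) ->
  J1 *m I x = - (I x *m J1) -> J2 *m I x = - (I x *m J2) ->
  let K := 2^-1 *: (E - I x *m E *m I x) + 4^-1 *: (J1 *m J2 - J2 *m J1) in
  (exists k, K^T *m G x = k *: kahler_form G I x) <->
  asd_part G o x (E^T *m G x) = 0.
Proof.
move=> skE sk1 sk2 an1 an2 K.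
have skA : (E^T *m G x)^T = - (E^T *m G x).
  have EG : E^T *m G x = - (G x *m E) by rewrite -skE trmx_mul GT.
  by rewrite EG linearN /= skE.
have an J : J *m I x = - (I x *m J) -> frame_end J *m stdI R = - (stdI R *m frame_end J).
  by move=> anJ; rewrite -frame_end_acs -!frame_endM anJ frame_endN.
have skE' := frame_end_skew skE.
rewrite (asd_part_eq0 skA) frame_form.
have -> : selfdual (frame_end E)^T <-> selfdual (frame_end E).
  rewrite skE' -scaleN1r; split; last exact: selfdualZ.
  by apply: selfdual_scaleP; rewrite oppr_eq0 oner_eq0.
rewrite -(selfdual_canonical skE' (frame_end_skew sk1) (frame_end_skew sk2) (an _ an1) (an _ an2)).
rewrite scale_stdIE.
have -> : 2^-1 *: (frame_end E - stdI R *m frame_end E *m stdI R)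
  + 4^-1 *: (frame_end J1 *m frame_end J2 - frame_end J2 *m frame_end J1) = frame_end K.
  by rewrite /K -frame_end_acs -!frame_endM -!frame_endN -!frame_endD -!frame_endZ -frame_endD.
split=> -[k Ek]; exists k.
  apply: trmx_inj; rewrite -frame_form Ek -scalemxAr -scalemxAl kahler_frame.
  by rewrite linearZ.
by apply: frame_inj; rewrite frame_form Ek -scalemxAr -scalemxAl kahler_frame linearZ.
Qed.

Variable Rm : 'I_4 -> 'I_4 -> 'M[R]_4.
Hypothesis skRm : forall a b, Rm b a = - Rm a b.
Hypothesis skRm' : forall a b, (Rm a b)^T = - Rm a b.
Hypothesis bianchiRm : forall a b c d, Rm a b c d + Rm b c a d + Rm c a b d = 0.

Let T := frame_comp P Rm.
Let skT := frame_comp_skew P skRm.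
Let skT' := frame_comp_skew' P skRm'.
Let bianchiT := frame_comp_bianchi P bianchiRm.

Let Ric : 'M[R]_4 := \matrix_(a, c) \sum_b \sum_d invmx (G x) b d * Rm a b c d.

Lemma ricci_frame i j : \sum_k T i k j k = (P^T *m Ric *m P) i j.
Proof.
have -> : (P^T *m Ric *m P) i j = \sum_a \sum_c \sum_b \sum_d \sum_k
    P a i * P b k * P c j * P d k * Rm a b c d.
  rewrite mxE exchange_big /=; apply: eq_bigr => c _.
  rewrite mxE mulr_suml; apply: eq_bigr => a _.
  rewrite !mxE mulr_sumr mulr_suml; apply: eq_bigr => b _.
  rewrite mulr_sumr mulr_suml; apply: eq_bigr => d _.
  rewrite inv_metric mxE mulr_suml mulr_sumr mulr_suml; apply: eq_bigr => k _.
  by rewrite !mxE; ring.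
under eq_bigr => k _ do rewrite /T frame_compE.
rewrite exchange_big /=; apply: eq_bigr => a _.
rewrite exchange_big /= [RHS]exchange_big /=; apply: eq_bigr => b _.
rewrite exchange_big /=; apply: eq_bigr => c _.
by rewrite exchange_big.
Qed.

Lemma asd_curvature_ricci : (forall a b, asd_part G o x (Rm a b) = 0) ->
  forall a c, \sum_b \sum_d invmx (G x) b d * Rm a b c d = 0.
Proof.
move=> asd0 a c.
have sdT i j : selfdual (T i j).
  rewrite /T /frame_comp mulmx_sumr mulmx_suml; apply: selfdual_sum => d.
  rewrite mulmx_sumr mulmx_suml; apply: selfdual_sum => b.
  by rewrite -scalemxAr -scalemxAl; apply: selfdualZ; apply/asd_part_eq0.
have Ric0 : Ric = 0.
  apply: frame_inj; apply/matrixP => i j; rewrite -ricci_frame.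
  by rewrite (selfdual_ricci_flat skT skT' bianchiT sdT) mulmx0 mul0mx mxE.
by have /matrixP/(_ a c) := Ric0; rewrite !mxE.
Qed.

Let Rop A : 'M[R]_4 := 2^-1 *: \sum_a \sum_b raise G x A a b *: Rm a b.

Let Rop_skew A : (Rop A)^T = - Rop A.
Proof.
rewrite /Rop linearZ /= -scalerN; congr (_ *: _); rewrite linear_sum /= -sumrN.
apply: eq_bigr => a _; rewrite linear_sum /= -sumrN; apply: eq_bigr => b _.
by rewrite linearZ /= skRm' scalerN.
Qed.

Lemma asd_curvature_op A : (forall a b, asd_part G o x (Rm a b) = 0) ->
  asd_part G o x (Rop A) = 0.
Proof.
move=> asd0; apply/(asd_part_eq0 (Rop_skew A)); rewrite /Rop -scalemxAr -scalemxAl.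
apply: selfdualZ; rewrite mulmx_sumr mulmx_suml; apply: selfdual_sum => a.
rewrite mulmx_sumr mulmx_suml; apply: selfdual_sum => b.
by rewrite -scalemxAr -scalemxAl; apply: selfdualZ; apply/asd_part_eq0.
Qed.

Lemma ricci_weyl_asd_curvature :
  (forall a c, \sum_b \sum_d invmx (G x) b d * Rm a b c d = 0) ->
  (forall A, A^T = - A -> asd_part G o x (Rop (asd_part G o x A)) = 0) ->
  forall a b, asd_part G o x (Rm a b) = 0.
Proof.
move=> ric0 weyl0.
have RicT i j : \sum_k T i k j k = 0.
  rewrite ricci_frame (_ : Ric = 0) ?mulmx0 ?mul0mx ?mxE //.
  by apply/matrixP => a c; rewrite mxE ric0 mxE.
have sd (w : 'M[R]_4) : w^T = - w ->
    selfdual (\sum_i \sum_j (w - star w) i j *: T i j).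
  move=> skw; pose A := G x *m P *m w *m (G x *m P)^T.
  have PAP : P^T *m A *m P = w.
    rewrite /A !mulmxA PGP mul1mx -mulmxA trmx_mul GT PGP mulmx1 //.
  have skA : A^T = - A.
    rewrite /A; move: (G x *m P) => M.
    by rewrite !trmx_mul trmxK skw mulNmx mulmxN mulmxA.
  have /asd_part_eq0 := weyl0 A skA; move/(_ (Rop_skew _)).
  rewrite /Rop raiseE asd_part_frame PAP -scalemxAr -scalemxAl frame_comp_sum.
  move/(selfdual_scaleP _); rewrite invr_eq0 pnatr_eq0 => /(_ isT).
  under eq_bigr => i _ do under eq_bigr => j _ do rewrite scalemxE -scalerA.
  under eq_bigr => i _ do rewrite -scaler_sumr.
  rewrite -scaler_sumr; move/(selfdual_scaleP _); rewrite invr_eq0 pnatr_eq0.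
  exact.
have sdw a b c d k : star (wedge R a b) = k *: wedge R c d ->
    selfdual (T a b - k *: T c d).
  move=> sw; have := sd _ (wedge_skew R a b); rewrite sw.
  under eq_bigr => i _ do under eq_bigr => j _ do
    rewrite addmxE oppmxE scalemxE scalerBl -scalerA.
  under eq_bigr => i _ do rewrite sumrB -scaler_sumr.
  rewrite sumrB -scaler_sumr !(sum_wedge _ _ skT) scalerA mulrC -scalerA -scalerBr.
  by apply: selfdual_scaleP; rewrite pnatr_eq0.
have sd1 : selfdual (T o0 o1 - T o2 o3).
  by rewrite -[T o2 o3]scale1r; apply: sdw; rewrite star_wedge01 scale1r.
have sd2 : selfdual (T o0 o2 + T o1 o3).
  rewrite -[T o1 o3]opprK -[- T o1 o3]scaleN1r; apply: sdw.
  by rewrite star_wedge02 scaleN1r.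
have sd3 : selfdual (T o0 o3 - T o1 o2).
  by rewrite -[T o1 o2]scale1r; apply: sdw; rewrite star_wedge03 scale1r.
move=> a b; apply/(asd_part_eq0 (skRm' a b)).
rewrite (frame_comp_inv Rm a b frame_inv).
apply: selfdual_sum => i; apply: selfdual_sum => j; apply: selfdualZ.
exact: (ricci_flat_selfdual skT skT' bianchiT RicT sd1 sd2 sd3).
Qed.

End PointwiseFrame.

(** * The equivalence in a chart *)

Lemma innerE (R : realType) (G : 'cV[R]_4 -> 'M[R]_4) x (L : 'M[R]_4) (z w : 'cV[R]_4) :
  inner G x (L *m z) w = (z^T *m (L^T *m G x) *m w) 0 0.
Proof. by rewrite /inner trmx_mul !mulmxA. Qed.

Lemma evec_form (R : realType) (A : 'M[R]_4) a b :
  ((evec R a)^T *m A *m evec R b) 0 0 = A a b.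
Proof. by rewrite /evec trmx_delta -colE -rowE !mxE. Qed.

Lemma sum_cframe (R : realType) m n (F : 'I_4 -> 'I_4 -> 'M[R]_(m, n)) a b x :
  \sum_i \sum_j (@cframe R a x i 0 * @cframe R b x j 0) *: F i j = F a b.
Proof.
rewrite (bigD1 a) //= [X in _ + X]big1 ?addr0 => [|c ca]; last first.
  by rewrite big1 // => d _; rewrite !mxE (negbTE ca) mul0r scale0r.
rewrite (bigD1 b) //= [X in _ + X]big1 ?addr0 => [|d db]; last first.
  by rewrite !mxE (negbTE db) mulr0 scale0r.
by rewrite !mxE !eqxx mulr1 scale1r.
Qed.

Section Chart.
Variables (R : realType) (U : set 'cV[R]_4).
Hypothesis oU : open U.
Variables (G I : 'cV[R]_4 -> 'M[R]_4) (o : 'cV[R]_4 -> R).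
Hypothesis sG : smooth_mx U G.
Hypothesis symG : forall x, U x -> (G x)^T = G x.
Hypothesis posG : forall x, U x -> forall u : 'cV[R]_4, u != 0 ->
  0 < (u^T *m G x *m u) 0 0.
Hypothesis sI : smooth_mx U I.
Hypothesis sqI : forall x, U x -> I x *m I x = - 1%:M.
Hypothesis isoI : forall x, U x -> (I x)^T *m G x *m I x = G x.
Hypothesis hodge_kahler : forall x, U x ->
  hodge G (o x) x (kahler_form G I x) = kahler_form G I x.
Implicit Types (X Y Z W : 'cV[R]_4 -> 'cV[R]_4).

Let uG x : U x -> G x \in unitmx.
Proof.
move=> Ux; have [P [PGP _]] := adapted_frame (symG Ux) (posG Ux) (sqI Ux) (isoI Ux).
exact: metric_unit PGP.
Qed.

Let Kt := curvmx (canonical_mx G I).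
Let K := curvmx (christoffel_mx G).
Let Rm x a b : 'M[R]_4 := (K a b x)^T *m G x.

Let Rm_skew x a b : U x -> Rm x b a = - Rm x a b.
Proof. by move=> Ux; rewrite /Rm /K (curvmx_skew (christoffel_mx G) a b) linearN mulNmx. Qed.

Let Rm_skew' x a b : U x -> (Rm x a b)^T = - Rm x a b.
Proof.
move=> Ux; have E := curvmx_metric_skew oU sG uG symG a b Ux.
by rewrite /Rm trmx_mul trmxK symG // -[in LHS](opprK (G x *m _)) -E trmx_mul symG.
Qed.

Let Rm_bianchi x a b c d : U x -> Rm x a b c d + Rm x b c a d + Rm x c a b d = 0.
Proof.
move=> Ux.
have E i j l : Rm x i j l d = \sum_k K i j x k l * G x k d.
  by rewrite /Rm [LHS]mxE; apply: eq_bigr => k _; rewrite trmxE.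
apply: etrans (congr2 +%R (congr2 +%R (E a b c) (E b c a)) (E c a b)) _.
rewrite -!big_split big1 //= => k _; rewrite -!mulrDl -[RHS](mul0r (G x k d)).
by congr (_ * _); exact: (curvmx_bianchi oU symG).
Qed.

Lemma asd_curvature_kahler x a b : U x ->
  (exists k, (Kt a b x)^T *m G x = k *: kahler_form G I x) <->
  asd_part G (o x) x (Rm x a b) = 0.
Proof.
move=> Ux.
have [P [PGP IP]] := adapted_frame (symG Ux) (posG Ux) (sqI Ux) (isoI Ux).
rewrite /Kt (curvmx_canonical oU sG uG sI sqI a b Ux).
exact: (canonical_kahler_selfdual (symG Ux) PGP IP (hodge_kahler Ux)
  (curvmx_metric_skew oU sG uG symG a b Ux)
  (nabla_acs_skew oU sG uG symG sI sqI isoI a Ux)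
  (nabla_acs_skew oU sG uG symG sI sqI isoI b Ux)
  (nabla_acs_anti oU G sI sqI a Ux) (nabla_acs_anti oU G sI sqI b Ux)).
Qed.

Lemma canonical_curvatureE X Y Z x :
  smooth_mx U X -> smooth_mx U Y -> smooth_mx U Z -> U x ->
  curvature (canonical_connection G I) X Y Z x =
  (\sum_i \sum_j (X x i 0 * Y x j 0) *: Kt i j x) *m Z x.
Proof.
move=> sX sY sZ Ux; rewrite (curvature_canonical oU sG uG sI sqI sX sY sZ Ux).
rewrite mulmx_suml; apply: eq_bigr => i _; rewrite mulmx_suml.
by apply: eq_bigr => j _; rewrite -scalemxAl.
Qed.

Lemma canonical_curvature_form X Y x : smooth_mx U X -> smooth_mx U Y -> U x ->
  curvature_form G (canonical_connection G I) X Y x =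
  (\sum_i \sum_j (X x i 0 * Y x j 0) *: Kt i j x)^T *m G x.
Proof.
move=> sX sY Ux; apply/matrixP => c d; rewrite [LHS]mxE.
rewrite (canonical_curvatureE sX sY (smooth_mx_cst oU _) Ux) innerE.
exact: evec_form.
Qed.

Lemma curvature_generated_chart :
  (forall X Y Z W, smooth_mx U X -> smooth_mx U Y -> smooth_mx U Z -> smooth_mx U W ->
    forall x, U x ->
      inner G x (curvature (canonical_connection G I) X Y Z x) (W x)
      = 2^-1 * chern_form G I X Y x * inner G x (I x *m Z x) (W x)) <->
  forall x, U x -> forall a b, asd_part G (o x) x (Rm x a b) = 0.
Proof.
have scf a : smooth_mx U (@cframe R a) by exact: smooth_mx_cst.
split=> [gen x Ux a b|asd0 X Y Z W sX sY sZ sW x Ux].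
  apply/(asd_curvature_kahler a b Ux).
  exists (2^-1 * chern_form G I (@cframe R a) (@cframe R b) x).
  apply/matrixP => c d; rewrite scalemxE kahler_formE.
  have := gen _ _ _ _ (scf a) (scf b) (scf c) (scf d) x Ux.
  by rewrite canonical_curvatureE // sum_cframe !innerE !evec_form.
have [P [PGP IP]] := adapted_frame (symG Ux) (posG Ux) (sqI Ux) (isoI Ux).
rewrite /chern_form canonical_curvatureE // canonical_curvature_form // !innerE.
set L := \sum_i _.
have E : L^T *m G x = (2^-1 * inner2 G x (L^T *m G x) (kahler_form G I x))
                      *: kahler_form G I x.
  apply/(kahler_multiple PGP IP).
  pose k i j := 2^-1 * inner2 G x ((Kt i j x)^T *m G x) (kahler_form G I x).
  exists (\sum_i \sum_j (X x i 0 * Y x j 0) * k i j).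
  rewrite /L linear_sum mulmx_suml scaler_suml; apply: eq_bigr => i _.
  rewrite linear_sum mulmx_suml scaler_suml; apply: eq_bigr => j _.
  rewrite linearZ /= -scalemxAl -[RHS]scalerA; congr (_ *: _).
  exact: (kahler_multiple PGP IP _).2 ((asd_curvature_kahler i j Ux).2 (asd0 x Ux i j)).
by rewrite [in LHS]E -scalemxAr -scalemxAl scalemxE kahler_formE.
Qed.

Lemma levi_civita_cframe a b Z x : smooth_mx U Z -> U x ->
  curvature (levi_civita G) (@cframe R a) (@cframe R b) Z x = K a b x *m Z x.
Proof.
move=> sZ Ux.
rewrite (curvature_levi_civita oU sG uG (smooth_mx_cst oU _) (smooth_mx_cst oU _) sZ Ux).
exact: (sum_cframe (fun i j => K i j x *m Z x)).
Qed.

Lemma riemE a b c d x : U x -> riem G x a b c d = Rm x a b c d.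
Proof.
move=> Ux; rewrite /riem [LHS]mxE (levi_civita_cframe a b (smooth_mx_cst oU _) Ux) innerE.
exact: evec_form.
Qed.

Lemma ricE a c x : U x -> ric G x a c = \sum_b K a b x b c.
Proof.
move=> Ux; apply: eq_bigr => b _.
by rewrite (levi_civita_cframe a b (smooth_mx_cst oU _) Ux) -colE mxE.
Qed.

Lemma ric_contraction a c x : U x ->
  \sum_b \sum_d invmx (G x) b d * Rm x a b c d = ric G x a c.
Proof.
move=> Ux; rewrite ricE //; apply: eq_bigr => b _.
have -> : K a b x b c = (Rm x a b *m invmx (G x)) c b.
  by rewrite /Rm -mulmxA mulmxV ?uG // mulmx1 trmxE.
rewrite mxE; apply: eq_bigr => d _; rewrite mulrC; congr (_ * _).
by rewrite -[in LHS](symG Ux) -trmx_inv mxE.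
Qed.

Lemma ricciE X Y x : smooth_mx U X -> smooth_mx U Y -> U x ->
  ricci G X Y x = \sum_i \sum_l X x i 0 * Y x l 0 * ric G x i l.
Proof.
move=> sX sY Ux; rewrite /ricci.
have cfE k j : @cframe R k x j 0 = (j == k)%:R by rewrite !mxE eqxx andbT.
under eq_bigr => k _.
  rewrite (curvature_levi_civita oU sG uG sX (smooth_mx_cst oU _) sY Ux) summxE.
  under eq_bigr => i _.
    rewrite summxE (bigD1 k) //= [X in _ + X]big1 => [|j jk]; last first.
      by rewrite scalemxE cfE (negbTE jk) mulr0 mul0r.
    rewrite addr0 scalemxE cfE eqxx mulr1 mxE mulr_sumr.
    over.
  over.
rewrite exchange_big /=; apply: eq_bigr => i _.
rewrite exchange_big /=; apply: eq_bigr => l _.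
rewrite ricE // mulr_sumr; apply: eq_bigr => k _.
by rewrite [X in _ * X]mulrC mulrA.
Qed.

Lemma ricci_flat_chart :
  (forall X Y, smooth_mx U X -> smooth_mx U Y -> forall x, U x -> ricci G X Y x = 0)
  <-> forall x, U x -> forall a b, ric G x a b = 0.
Proof.
split=> [ric0 x Ux a b|ric0 X Y sX sY x Ux].
  by apply: ric0 => //; exact: smooth_mx_cst.
rewrite ricciE // big1 // => i _; rewrite big1 // => l _.
by rewrite ric0 // mulr0.
Qed.

Lemma weyl_op_ricci_flat x A : U x -> (forall a b, ric G x a b = 0) ->
  weyl_op G x A = 2^-1 *: \sum_a \sum_b raise G x A a b *: Rm x a b.
Proof.
move=> Ux ric0; apply/matrixP => c d; rewrite mxE scalemxE; congr (_ * _).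
rewrite summxE; apply: eq_bigr => a _; rewrite summxE; apply: eq_bigr => b _.
rewrite scalemxE; congr (_ * _); rewrite /weyl riemE //.
have -> : scalar_curvature G x = 0.
  by rewrite /scalar_curvature big1 // => e _; rewrite big1 // => f _; rewrite ric0 mulr0.
by rewrite !ric0; ring.
Qed.

Lemma asd_curvature_chart :
  (forall x, U x -> forall a b, asd_part G (o x) x (Rm x a b) = 0) <->
  (forall x, U x -> forall a b, ric G x a b = 0) /\
  (forall x, U x -> forall A : 'M[R]_4, A^T = - A -> weyl_minus G (o x) x A = 0).
Proof.
split=> [asd0|[ric0 weyl0] x Ux].
  have ric0 x : U x -> forall a b, ric G x a b = 0.
    move=> Ux a b; rewrite -ric_contraction //.
    have [P [PGP IP]] := adapted_frame (symG Ux) (posG Ux) (sqI Ux) (isoI Ux).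
    apply: (asd_curvature_ricci PGP IP (hodge_kahler Ux)).
    - by move=> c d; apply: Rm_skew.
    - by move=> c d; apply: Rm_skew'.
    - by move=> c d e f; apply: Rm_bianchi.
    - exact: asd0.
  split=> // x Ux A _; rewrite /weyl_minus weyl_op_ricci_flat //; last exact: ric0.
  have [P [PGP IP]] := adapted_frame (symG Ux) (posG Ux) (sqI Ux) (isoI Ux).
  apply: (asd_curvature_op PGP IP (hodge_kahler Ux)) (asd0 x Ux).
  by move=> c d; apply: Rm_skew'.
have [P [PGP IP]] := adapted_frame (symG Ux) (posG Ux) (sqI Ux) (isoI Ux).
apply: (ricci_weyl_asd_curvature (symG Ux) PGP IP (hodge_kahler Ux)).
- by move=> c d; apply: Rm_skew.
- by move=> c d; apply: Rm_skew'.
- by move=> c d e f; apply: Rm_bianchi.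
- by move=> c d; rewrite ric_contraction // ric0.
move=> A skA; rewrite -weyl_op_ricci_flat //; last exact: ric0.
exact: weyl0.
Qed.

End Chart.

Theorem proposition5p1 (R : realType) (M : manifold4 R)
    (H : almost_hermitian M) (o : orientation M)
    (Ho : kahler_selfdual H o) :
  curvature_generated_by_kahler H <-> (ricci_flat H /\ weyl_minus_zero H o).
Proof.
have gen c := curvature_generated_chart (@img_open R M c) (metric_smooth H c)
  (@Defs.metric_sym _ _ H c) (@metric_pos _ _ H c) (acs_smooth H c)
  (@acs_sqr _ _ H c) (@acs_isometry _ _ H c) (Ho c).
have ric c := ricci_flat_chart (@img_open R M c) (metric_smooth H c)
  (@Defs.metric_sym _ _ H c) (@metric_pos _ _ H c)
  (@acs_sqr _ _ H c) (@acs_isometry _ _ H c).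
have main c := asd_curvature_chart (@img_open R M c) (metric_smooth H c)
  (@Defs.metric_sym _ _ H c) (@metric_pos _ _ H c)
  (@acs_sqr _ _ H c) (@acs_isometry _ _ H c) (Ho c).
split=> [cg|[rf wm]].
  have cm c := (main c).1 ((gen c).1 (cg c)).
  by split=> [c|c]; [apply/(ric c)/(cm c).1|exact: (cm c).2].
by move=> c; apply/(gen c)/(main c); split; [exact/(ric c)/rf|exact: wm].
Qed.
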